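(* Let $\phi=\tilde p/p$ be a rational inner function on $\mathbb{D}^2$ that does not extend continuously to $\overline{\mathbb{D}^2}$. Then $\frac{\partial\phi}{\partial z_j}\notin H^{\mathfrak p}(\mathbb{D}^2)$ for $j=1,2$ and all $\frac32\le\mathfrak p\le\infty$.
   Context: $\phi=\tilde p/p$ where $p\in\mathbb{C}[z_1,z_2]$ has bidegree $(m,n)$, no zeros in $\mathbb{D}^2$, is atoral (finitely many zeros on $\mathbb{T}^2$, no common factor with $\tilde p$), and $\tilde p(z)=z_1^mz_2^n\overline{p(1/\bar z_1,1/\bar z_2)}$. $H^{\mathfrak p}(\mathbb{D}^2)$ for $0<\mathfrak p<\infty$ consists of holomorphic $f$ with $\sup_{0<r<1}\frac{1}{4\pi^2}\int_{\mathbb{T}^2}|f(r\zeta)|^{\mathfrak p}|d\zeta|<\infty$; $H^\infty(\mathbb{D}^2)$ is the space of bounded holomorphic functions. *)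

(* Defs.v *)
From Stdlib Require Import Reals Lra Lia Classical ClassicalEpsilon.
Open Scope R_scope.

Definition Cx := (R * R)%type.
Definition RtoC (r : R) : Cx := (r, 0).
Definition C0 : Cx := (0, 0).
Definition C1 : Cx := (1, 0).
Definition Cadd (z w : Cx) : Cx := (fst z + fst w, snd z + snd w).
Definition Copp (z : Cx) : Cx := (- fst z, - snd z).
Definition Csub (z w : Cx) : Cx := Cadd z (Copp w).
Definition Cmul (z w : Cx) : Cx :=
  (fst z * fst w - snd z * snd w, fst z * snd w + snd z * fst w).
Definition Cconj (z : Cx) : Cx := (fst z, - snd z).
Definition Cnorm (z : Cx) : R := sqrt (fst z * fst z + snd z * snd z).
Definition Cinv (z : Cx) : Cx :=
  let d := fst z * fst z + snd z * snd z in (fst z / d, - snd z / d).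
Definition Cdiv (z w : Cx) : Cx := Cmul z (Cinv w).
Fixpoint Cpow (z : Cx) (n : nat) : Cx :=
  match n with O => C1 | S k => Cmul z (Cpow z k) end.
Definition Cscale (r : R) (z : Cx) : Cx := (r * fst z, r * snd z).
Definition Cexpi (t : R) : Cx := (cos t, sin t).

Fixpoint Csum (n : nat) (f : nat -> Cx) : Cx :=
  match n with O => C0 | S k => Cadd (Csum k f) (f k) end.

Definition inD (z : Cx) : Prop := Cnorm z < 1.
Definition inT (z : Cx) : Prop := Cnorm z = 1.
Definition inDbar (z : Cx) : Prop := Cnorm z <= 1.
Definition inD2 (z1 z2 : Cx) : Prop := inD z1 /\ inD z2.
Definition inT2 (z1 z2 : Cx) : Prop := inT z1 /\ inT z2.
Definition inD2bar (z1 z2 : Cx) : Prop := inDbar z1 /\ inDbar z2.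

(* A polynomial is given by degree bounds and coefficients; only the
   coefficients c i j with i <= pd1, j <= pd2 matter. *)
Record poly2 := Poly2 { pd1 : nat; pd2 : nat; coef : nat -> nat -> Cx }.

Definition peval (P : poly2) (z1 z2 : Cx) : Cx :=
  Csum (S (pd1 P)) (fun i =>
    Csum (S (pd2 P)) (fun j =>
      Cmul (coef P i j) (Cmul (Cpow z1 i) (Cpow z2 j)))).

Definition has_bidegree (P : poly2) (m n : nat) : Prop :=
  pd1 P = m /\ pd2 P = n /\
  (exists j, (j <= n)%nat /\ coef P m j <> C0) /\
  (exists i, (i <= m)%nat /\ coef P i n <> C0).

(* reflection  p~(z) = z1^m z2^n conj(p(1/conj z1, 1/conj z2)),
   written on coefficients: p~_{ij} = conj(p_{m-i, n-j}) *)
Definition ptilde (P : poly2) : poly2 :=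
  Poly2 (pd1 P) (pd2 P)
        (fun i j => Cconj (coef P (pd1 P - i) (pd2 P - j))).

Definition nonconstant (Q : poly2) : Prop :=
  exists i j, (i <= pd1 Q)%nat /\ (j <= pd2 Q)%nat /\ (i + j > 0)%nat /\
              coef Q i j <> C0.

Definition pdivides (Q P : poly2) : Prop :=
  exists S : poly2, forall z1 z2,
    peval P z1 z2 = Cmul (peval Q z1 z2) (peval S z1 z2).

Definition no_common_factor (P Q : poly2) : Prop :=
  ~ exists F : poly2, nonconstant F /\ pdivides F P /\ pdivides F Q.

Definition no_zeros_in_D2 (P : poly2) : Prop :=
  forall z1 z2, inD2 z1 z2 -> peval P z1 z2 <> C0.

Definition finitely_many_zeros_on_T2 (P : poly2) : Prop :=
  exists L : list (Cx * Cx), forall z1 z2,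
    inT2 z1 z2 -> peval P z1 z2 = C0 -> List.In (z1, z2) L.

Definition atoral (P : poly2) : Prop :=
  finitely_many_zeros_on_T2 P /\ no_common_factor P (ptilde P).

Definition RIF (P : poly2) (z1 z2 : Cx) : Cx :=
  Cdiv (peval (ptilde P) z1 z2) (peval P z1 z2).

Definition extends_continuously_to_closed_bidisc (F : Cx -> Cx -> Cx) : Prop :=
  exists G : Cx -> Cx -> Cx,
    (forall z1 z2, inD2 z1 z2 -> G z1 z2 = F z1 z2) /\
    (forall w1 w2, inD2bar w1 w2 -> forall eps, eps > 0 ->
       exists delta, delta > 0 /\
         forall z1 z2, inD2bar z1 z2 ->
           Cnorm (Csub z1 w1) < delta -> Cnorm (Csub z2 w2) < delta ->
           Cnorm (Csub (G z1 z2) (G w1 w2)) < eps).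

Definition is_partial1_at (F : Cx -> Cx -> Cx) (z1 z2 d : Cx) : Prop :=
  forall eps, eps > 0 -> exists delta, delta > 0 /\
    forall h, h <> C0 -> Cnorm h < delta ->
      Cnorm (Csub (Cdiv (Csub (F (Cadd z1 h) z2) (F z1 z2)) h) d) < eps.
Definition is_partial2_at (F : Cx -> Cx -> Cx) (z1 z2 d : Cx) : Prop :=
  forall eps, eps > 0 -> exists delta, delta > 0 /\
    forall h, h <> C0 -> Cnorm h < delta ->
      Cnorm (Csub (Cdiv (Csub (F z1 (Cadd z2 h)) (F z1 z2)) h) d) < eps.

Definition is_partial (j : nat) (F f : Cx -> Cx -> Cx) : Prop :=
  forall z1 z2, inD2 z1 z2 ->
    (j = 1%nat -> is_partial1_at F z1 z2 (f z1 z2)) /\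
    (j = 2%nat -> is_partial2_at F z1 z2 (f z1 z2)).

Definition holomorphic_D2 (f : Cx -> Cx -> Cx) : Prop :=
  (forall w1 w2, inD2 w1 w2 -> forall eps, eps > 0 ->
     exists delta, delta > 0 /\
       forall z1 z2, Cnorm (Csub z1 w1) < delta -> Cnorm (Csub z2 w2) < delta ->
         Cnorm (Csub (f z1 z2) (f w1 w2)) < eps) /\
  (forall z1 z2, inD2 z1 z2 ->
     (exists d, is_partial1_at f z1 z2 d) /\ (exists d, is_partial2_at f z1 z2 d)).

Definition RInt (f : R -> R) (a b : R) : R :=
  match excluded_middle_informative (inhabited (Riemann_integrable f a b)) with
  | left H => RiemannInt (epsilon H (fun _ => True))
  | right _ => 0
  end.

(* x^p for x >= 0, p > 0 (with 0^p = 0) *)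
Definition rpow (x p : R) : R := if Rle_dec x 0 then 0 else Rpower x p.

Definition torus_mean (f : Cx -> Cx -> Cx) (p r : R) : R :=
  / (4 * PI ^ 2) *
  RInt (fun t1 => RInt (fun t2 =>
          rpow (Cnorm (f (Cscale r (Cexpi t1)) (Cscale r (Cexpi t2)))) p)
        0 (2 * PI)) 0 (2 * PI).

Definition in_Hp (p : R) (f : Cx -> Cx -> Cx) : Prop :=
  holomorphic_D2 f /\
  exists M, forall r, 0 < r < 1 -> torus_mean f p r <= M.

Definition in_Hinf (f : Cx -> Cx -> Cx) : Prop :=
  holomorphic_D2 f /\ exists M, forall z1 z2, inD2 z1 z2 -> Cnorm (f z1 z2) <= M.

(* Main.v *)
Require Import Defs.
From Stdlib Require Import Reals Lra Lia List Classical.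
From Stdlib Require FunctionalExtensionality ClassicalEpsilon.
From mathcomp Require all_boot all_algebra complex Rstruct.
From Coquelicot Require Import Coquelicot.
Open Scope R_scope.

(** Since [RIF p] does not extend, p vanishes at some (tau1, tau2) on the torus.  For
    v = tau2 e^{it} write p(z, v) = L(t) prod_k (1 - g_k(t) z); stability of p gives
    |g_k| <= 1.  The roots g_k(t) need not be smooth in t, but symmetric functions of them
    are.  With a polynomial G that agrees to high order with tau1 u at u = 1/tau1 and with 1
    at the other roots for t = 0, the product of the |G(g_k(t))|^2 is (by a resultant
    identity) smooth in t, at most 1 + O(t^2), and equal to 1 at t = 0; hence it is also at
    least 1 - O(t^2), and some root g satisfies y := 1 - |g| = O(t^2).

    By Schwarz-Pick for the Blaschke product RIF p (., v), the derivative is at least of order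
    1/y on an arc of length y, so the slice integral of its q-th power is at least of order
    y^(1-q), that is 1/|t| when q >= 3/2, which is not integrable at t = 0. *)

(** Smoothness in t is used only as an expansion a + t b + O(t^2) on [-1, 1]. The unknown roots
    g_k(t) admit no such expansion in general. The resultant identity trades the product of
    |G(g_k(t))| over them for a product, over the fixed roots of G, of values of the reversed
    polynomial z^m p(1/z, v), which is polynomial in e^{it}. Moduli are squared because |F|^2 = F
    conj(F) keeps an expansion where |F| may lose it.

    The zeros of p on the torus forbid a direct passage to boundary values. The derivative is
    therefore written as a quotient [slope] of polynomials, meaningful on the closed bidisc off the
    zeros of p. Only t in a compact interval [eps, tm] is used, on which p has no zero over the
    circle. There [slope] is uniformly Lipschitz, so a single radius r close to 1 serves every
    slice, and integrating kap / t gives kap ln(tm / eps), which the choice of eps lifts above any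
    given M. *)

Inductive polyfun : (C -> C) -> Prop :=
| polyfun_const c : polyfun (fun _ => c)
| polyfun_id : polyfun (fun z => z)
| polyfun_plus f g : polyfun f -> polyfun g -> polyfun (fun z => Cplus (f z) (g z))
| polyfun_mult f g : polyfun f -> polyfun g -> polyfun (fun z => Cmult (f z) (g z)).

Definition prodC (h : C -> C) (l : list C) : C :=
  fold_right (fun a acc => Cmult (h a) acc) (RtoC 1) l.

(** * Factorization of complex polynomials into linear factors *)

Module FundamentalTheoremOfAlgebra.
Import all_boot all_algebra complex Rstruct.
Import GRing.Theory.

Local Notation K := (complex R).

Definition toK (z : C) : K := Complex (fst z) (snd z).
Definition ofK (z : K) : C := (complex.Re z, complex.Im z).

Lemma toKK (z : C) : ofK (toK z) = z.
Proof. by case: z. Qed.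

Lemma ofKK (z : K) : toK (ofK z) = z.
Proof. by case: z. Qed.

Lemma toKD (x y : C) : toK (Cplus x y) = (toK x + toK y)%R.
Proof. by []. Qed.

Lemma toKM (x y : C) : toK (Cmult x y) = (toK x * toK y)%R.
Proof. by []. Qed.

Lemma toKB (x y : C) : toK (Cminus x y) = (toK x - toK y)%R.
Proof. by []. Qed.

Lemma toKX (x : C) n : toK (Cpow x n) = (toK x ^+ n)%R.
Proof. by elim: n => [//|n IH]; rewrite exprS -IH. Qed.

Lemma polyfun_poly (f : C -> C) : polyfun f ->
  exists p : {poly K}, forall z, toK (f z) = (p.[toK z])%R.
Proof.
elim=> [c||g h _ [p Hp] _ [q Hq]|g h _ [p Hp] _ [q Hq]].
- by exists ((toK c)%:P)%R => z; rewrite hornerC.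
- by exists ('X)%R => z; rewrite hornerX.
- by exists (p + q)%R => z; rewrite hornerD -Hp -Hq.
- by exists (p * q)%R => z; rewrite hornerM -Hp -Hq.
Qed.

Lemma horner_prod_roots (r : seq K) (z : C) :
  (\prod_(x <- r) ('X - x%:P)).[toK z]%R
  = toK (prodC (fun a => Cminus z a) (map ofK r)).
Proof.
elim: r => [|a r IH]; first by rewrite big_nil hornerC.
by rewrite big_cons hornerM IH /= toKM toKB ofKK hornerXsubC.
Qed.

(** Supplies the roots of the selecting polynomial G for the resultant identity. The zero polynomial
    is covered, with c = 0. *)
Lemma polyfun_factor (f : C -> C) : polyfun f ->
  exists (c : C) (l : list C), forall z, f z = Cmult c (prodC (fun a => Cminus z a) l).
Proof.
move=> /polyfun_poly [p Hp].
have [r Hr] := @closed_field_poly_normal K p.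
exists (ofK (lead_coef p)), (map ofK r) => z.
rewrite -[LHS]toKK Hp {1}Hr hornerZ horner_prod_roots.
by rewrite -{1}(ofKK (lead_coef p)) -toKM toKK.
Qed.

Lemma horner_coeffs (a : nat -> C) m z :
  toK (Csum m (fun i => Cmult (a i) (Cpow z i)))
  = ((\poly_(i < m) toK (a i)).[toK z])%R.
Proof.
rewrite horner_poly; elim: m => [|m IH]; first by rewrite big_ord0.
by rewrite big_ord_recr /= -IH -toKX -toKM -toKD.
Qed.

(** The nonzero leading coefficient fixes the number of roots, so that all slices have equally many
    of them. *)
Lemma coeffs_factor (a : nat -> C) m : a m <> RtoC 0 ->
  exists l : list C, List.length l = m /\
    forall z, Csum (S m) (fun i => Cmult (a i) (Cpow z i))
              = Cmult (a m) (prodC (fun r => Cminus z r) l).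
Proof.
move=> Ha.
have Hn : (toK (a m) != 0)%R.
  by apply/eqP => H; apply: Ha; rewrite -(toKK (a m)) H.
set p := (\poly_(i < m.+1) toK (a i))%R.
have Hs : size p = m.+1 by rewrite size_poly_eq.
have Hl : lead_coef p = toK (a m) by rewrite lead_coefE Hs coef_poly leqnn.
have [r Hr] := @closed_field_poly_normal K p.
have Hsr : size r = m.
  have := Hs; rewrite {1}Hr Hl size_scale // size_prod_XsubC.
  by case.
exists (map ofK r); split; first by rewrite -Hsr; exact: size_map.
move=> z; rewrite -[LHS]toKK horner_coeffs -/p Hr Hl hornerZ horner_prod_roots.
by rewrite -toKM toKK.
Qed.

End FundamentalTheoremOfAlgebra.

(* [Cx] and Coquelicot's [C] are convertible but [ring] only recognises the latter. *)
Ltac Ceq :=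
  match goal with |- @eq _ ?a ?b => change (@eq C a b) end;
  repeat match goal with |- context [peval ?P ?z ?w] =>
    let x := fresh "x" in pose (x := peval P z w : C); change (peval P z w) with x; clearbody x
  end.

(** * Complex moduli and the exponential *)

Lemma Cnorm_Cmod (z : C) : Cnorm z = Cmod z.
Proof. unfold Cnorm, Cmod. f_equal. ring. Qed.

Lemma Defs_Cinv (z : C) : Defs.Cinv z = Cinv z.
Proof. unfold Defs.Cinv, Cinv. simpl. rewrite !Rmult_1_r. reflexivity. Qed.

Lemma Defs_Cdiv (z w : C) : Defs.Cdiv z w = Cdiv z w.
Proof. unfold Defs.Cdiv, Cdiv. rewrite Defs_Cinv. reflexivity. Qed.

Lemma Cexpi_plus (a b : R) : Cexpi (a + b) = Cmult (Cexpi a) (Cexpi b).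
Proof.
  unfold Cexpi, Cmult; simpl. rewrite cos_plus, sin_plus. f_equal; ring.
Qed.

Lemma Cmod_Cexpi (t : R) : Cmod (Cexpi t) = 1.
Proof.
  unfold Cmod, Cexpi; simpl.
  replace (cos t * (cos t * 1) + sin t * (sin t * 1)) with 1.
  - apply sqrt_1.
  - generalize (sin2_cos2 t); unfold Rsqr; lra.
Qed.

Lemma Cscale_mult (r : R) (z : C) : Cscale r z = Cmult (RtoC r) z.
Proof. unfold Cscale, Cmult, RtoC; simpl. f_equal; ring. Qed.

Lemma Cmod_sub_sym (x y : C) : Cmod (x - y) = Cmod (y - x).
Proof. replace (x - y)%C with (- (y - x))%C by ring. apply Cmod_opp. Qed.

Lemma Cmod_ge_sub (x y : C) : Cmod x - Cmod y <= Cmod (x - y).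
Proof.
  generalize (Cmod_triangle (x - y) y).
  replace (x - y + y)%C with x by ring. lra.
Qed.

Lemma Cmod_one_minus (x : C) : 1 - Cmod x <= Cmod (1 - x).
Proof. generalize (Cmod_ge_sub 1 x). rewrite Cmod_1. lra. Qed.

Lemma Cmod_minus_le (x y : C) : Cmod (x - y) <= Cmod x + Cmod y.
Proof.
  generalize (Cmod_triangle x (- y)). rewrite Cmod_opp. auto.
Qed.

Lemma Cmod_sqr (x : C) : Cmod x ^ 2 = fst x * fst x + snd x * snd x.
Proof.
  unfold Cmod. rewrite pow2_sqrt; simpl; nra.
Qed.

(** Stands in for the passage to the limit e -> 0 wherever an error term is linear in e. *)
Lemma Rle_of_forall_eps (x K : R) :
  (forall e, 0 < e <= 1 -> x <= K * e) -> x <= 0.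
Proof.
  intros H. destruct (Rle_lt_dec x 0) as [|Hx]; [assumption|exfalso].
  assert (HK : 0 < K) by (specialize (H 1); lra).
  assert (H1 : 0 < Rmin 1 (x / (2 * K))).
  { apply Rmin_glb_lt; [lra|]. apply Rdiv_lt_0_compat; lra. }
  assert (H2 := Rmin_l 1 (x / (2 * K))). assert (H3 := Rmin_r 1 (x / (2 * K))).
  assert (H4 := H _ (conj H1 H2)).
  assert (K * Rmin 1 (x / (2 * K)) <= K * (x / (2 * K))) by (apply Rmult_le_compat_l; lra).
  replace (K * (x / (2 * K))) with (x / 2) in * by (field; lra). lra.
Qed.

(** * Products over lists of roots *)

Definition prodR (h : C -> R) (l : list C) : R :=
  fold_right (fun a acc => h a * acc) 1 l.

Lemma Cmod_prodC (h : C -> C) l : Cmod (prodC h l) = prodR (fun a => Cmod (h a)) l.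
Proof.
  induction l as [|a l IH]; simpl.
  - apply Cmod_1.
  - rewrite Cmod_mult, IH. reflexivity.
Qed.

Lemma prodR_nonneg h l : (forall a, In a l -> 0 <= h a) -> 0 <= prodR h l.
Proof.
  induction l as [|a l IH]; simpl; intros H; [lra|].
  apply Rmult_le_pos; auto.
Qed.

Lemma prodR_le h k l :
  (forall a, In a l -> 0 <= h a <= k a) -> prodR h l <= prodR k l.
Proof.
  induction l as [|a l IH]; simpl; intros H; [lra|].
  apply Rmult_le_compat; [apply H; auto| |apply H; auto|apply IH; intros; apply H; auto].
  apply prodR_nonneg. intros x Hx. apply (H x); auto.
Qed.

Lemma prodR_const c l : prodR (fun _ => c) l = c ^ length l.
Proof. induction l as [|a l IH]; simpl; [|rewrite IH]; reflexivity. Qed.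

(** Every factor but the one at g is replaced by its bound. The bound at g may remain in the product
    on the right because it is at least 1. *)
Lemma prodR_le_one_factor h k g l :
  In g l -> (forall a, In a l -> 0 <= h a <= k a) -> (forall a, In a l -> 1 <= k a) ->
  prodR h l <= h g * prodR k l.
Proof.
  induction l as [|a l IH]; simpl; intros Hg H H1; [tauto|].
  assert (Hk : 0 <= prodR k l).
  { apply prodR_nonneg. intros x Hx. assert (A := H1 x (or_intror Hx)). lra. }
  assert (Hka := H1 a (or_introl eq_refl)). assert (Hha := H a (or_introl eq_refl)).
  destruct Hg as [->|Hg].
  - assert (prodR h l <= prodR k l) by (apply prodR_le; auto).
    apply Rmult_le_compat_l; [lra|]. nra.
  - assert (A := IH Hg (fun x hx => H x (or_intror hx)) (fun x hx => H1 x (or_intror hx))).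
    assert (Hh : 0 <= prodR h l).
    { apply prodR_nonneg. intros x Hx. apply (H x); auto. }
    assert (h a * prodR h l <= k a * prodR h l) by (apply Rmult_le_compat_r; lra).
    assert (k a * prodR h l <= k a * (h g * prodR k l)) by (apply Rmult_le_compat_l; lra).
    lra.
Qed.

Lemma prodR_ext h k l : (forall a, In a l -> h a = k a) -> prodR h l = prodR k l.
Proof.
  induction l as [|a l IH]; simpl; intros H; [reflexivity|].
  rewrite H, IH; auto.
Qed.

Lemma prodR_mult h k l : prodR (fun a => h a * k a) l = prodR h l * prodR k l.
Proof. induction l as [|a l IH]; simpl; [ring|rewrite IH; ring]. Qed.

Lemma prodC_ext h k l : (forall a, In a l -> h a = k a) -> prodC h l = prodC k l.
Proof.
  induction l as [|a l IH]; simpl; intros H; [reflexivity|].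
  rewrite H, IH; auto.
Qed.

Lemma prodC_scale c h l :
  prodC (fun a => (c * h a)%C) l = (Cpow c (length l) * prodC h l)%C.
Proof. induction l as [|a l IH]; simpl; [ring|rewrite IH; ring]. Qed.

Lemma prodC_zero (h : C -> C) a l : In a l -> h a = RtoC 0 -> prodC h l = RtoC 0.
Proof.
  intros Hin Ha. induction l as [|b l IH]; simpl in *; [tauto|].
  destruct Hin as [->|Hin].
  - rewrite Ha. ring.
  - rewrite (IH Hin). ring.
Qed.

(** * Finite sums, values of bivariate polynomials, reversal and reflection *)

Lemma Csum_ext n f g : (forall i, (i < n)%nat -> f i = g i) -> Csum n f = Csum n g.
Proof.
  intros H. induction n as [|n IH]; [reflexivity|].
  simpl. rewrite IH by (intros; apply H; lia). rewrite (H n) by lia. reflexivity.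
Qed.

Lemma Csum_plus n f g : Csum n (fun i => Cplus (f i) (g i)) = Cplus (Csum n f) (Csum n g).
Proof.
  induction n as [|n IH]; simpl.
  - change (RtoC 0 = RtoC 0 + RtoC 0)%C. Ceq; ring.
  - rewrite IH. change Cadd with Cplus. Ceq; ring.
Qed.

Lemma Csum_scal n c f : Csum n (fun i => Cmult c (f i)) = Cmult c (Csum n f).
Proof.
  induction n as [|n IH]; simpl.
  - change (RtoC 0 = c * RtoC 0)%C. Ceq; ring.
  - rewrite IH. change Cadd with Cplus. Ceq; ring.
Qed.

Lemma Csum_exchange n m (f : nat -> nat -> C) :
  Csum n (fun i => Csum m (fun j => f i j)) = Csum m (fun j => Csum n (fun i => f i j)).
Proof.
  induction n as [|n IH]; simpl.
  - induction m as [|m IHm]; simpl; [reflexivity|]. rewrite <- IHm.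
    change (RtoC 0 = RtoC 0 + RtoC 0)%C. Ceq; ring.
  - rewrite IH. symmetry. apply Csum_plus.
Qed.

Lemma Csum_head n f : Csum (S n) f = Cplus (f O) (Csum n (fun i => f (S i))).
Proof.
  induction n as [|n IH].
  - change (RtoC 0 + f O = f O + RtoC 0)%C. Ceq; ring.
  - change (Csum (S (S n)) f) with (Cplus (Csum (S n) f) (f (S n))). rewrite IH.
    change (Csum (S n) (fun i => f (S i)))
      with (Cplus (Csum n (fun i => f (S i))) (f (S n))). Ceq; ring.
Qed.

Lemma Csum_rev m f : Csum (S m) f = Csum (S m) (fun i => f (m - i)%nat).
Proof.
  revert f. induction m as [|m IH]; intros f; [reflexivity|].
  rewrite Csum_head. rewrite (IH (fun i => f (S i))).
  change (Csum (S (S m)) (fun i => f (S m - i)%nat))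
    with (Cplus (Csum (S m) (fun i => f (S m - i)%nat)) (f (S m - S m)%nat)).
  replace (S m - S m)%nat with O by lia.
  rewrite Cplus_comm. f_equal. apply Csum_ext. intros i Hi. f_equal. lia.
Qed.

Lemma Csum_conj n f : Cconj (Csum n f) = Csum n (fun i => Cconj (f i)).
Proof.
  induction n as [|n IH]; simpl.
  - unfold Cconj, C0; simpl. f_equal; ring.
  - rewrite <- IH. apply Cplus_conj.
Qed.

Lemma peval_Csum P z1 z2 :
  peval P z1 z2 = Csum (S (pd1 P)) (fun i => Csum (S (pd2 P)) (fun j =>
      Cmult (coef P i j) (Cmult (Cpow z1 i) (Cpow z2 j)))).
Proof. reflexivity. Qed.

Definition row (P : poly2) (i : nat) (w : C) : C :=
  Csum (S (pd2 P)) (fun j => Cmult (coef P i j) (Cpow w j)).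

Lemma peval_row P z w :
  peval P z w = Csum (S (pd1 P)) (fun i => Cmult (row P i w) (Cpow z i)).
Proof.
  rewrite peval_Csum. apply Csum_ext. intros i _. unfold row.
  rewrite Cmult_comm, <- Csum_scal. apply Csum_ext. intros; Ceq; ring.
Qed.

Lemma peval_0_l P w : peval P (RtoC 0) w = row P 0 w.
Proof.
  rewrite peval_row, Csum_head. simpl Cpow.
  rewrite (Csum_ext _ _ (fun i => Cmult (RtoC 0) (Cmult (row P (S i) w) (Cpow (RtoC 0) i)))).
  - rewrite Csum_scal. Ceq; ring.
  - intros i _. simpl. Ceq; ring.
Qed.

(** The reversal z^m p(1/z, w) in the first variable. Its leading coefficient in z is p(0, w), which
    stability keeps away from 0, so its degree in z does not drop. *)
Definition preverse (P : poly2) : poly2 :=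
  Poly2 (pd1 P) (pd2 P) (fun i j => coef P (pd1 P - i) j).

Lemma peval_preverse P z w : z <> RtoC 0 ->
  peval P z w = Cmult (Cpow z (pd1 P)) (peval (preverse P) (Cinv z) w).
Proof.
  intros Hz. rewrite !peval_row. rewrite <- Csum_scal, Csum_rev.
  apply Csum_ext. intros i Hi.
  change (row (preverse P) i w) with (row P (pd1 P - i) w).
  change (pd1 (preverse P)) with (pd1 P) in *.
  rewrite Cpow_inv by assumption.
  replace (Cpow z (pd1 P)) with (Cmult (Cpow z (pd1 P - i)) (Cpow z i)).
  - assert (Cpow z i <> RtoC 0) by (apply Cpow_nz; assumption). Ceq; field. assumption.
  - rewrite <- Cpow_add_r. f_equal. lia.
Qed.

(** Recovers the usual formula for the reflection from its coefficientwise definition. *)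
Lemma peval_ptilde P z w : z <> RtoC 0 -> w <> RtoC 0 ->
  peval (ptilde P) z w = Cmult (Cmult (Cpow z (pd1 P)) (Cpow w (pd2 P)))
     (Cconj (peval P (Cinv (Cconj z)) (Cinv (Cconj w)))).
Proof.
  intros Hz Hw. rewrite !peval_Csum.
  change (pd1 (ptilde P)) with (pd1 P). change (pd2 (ptilde P)) with (pd2 P).
  rewrite Csum_conj, <- Csum_scal, Csum_rev. apply Csum_ext. intros i Hi.
  rewrite Csum_conj, <- Csum_scal, Csum_rev. apply Csum_ext. intros j Hj.
  simpl coef. change Defs.Cconj with Cconj.
  replace (pd1 P - (pd1 P - i))%nat with i by lia.
  replace (pd2 P - (pd2 P - j))%nat with j by lia.
  assert (Hzc : Cconj z <> RtoC 0).
  { intros H. apply Hz. rewrite <- (Cconj_conj z), H. unfold Cconj, RtoC; simpl. f_equal; ring. }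
  assert (Hwc : Cconj w <> RtoC 0).
  { intros H. apply Hw. rewrite <- (Cconj_conj w), H. unfold Cconj, RtoC; simpl. f_equal; ring. }
  rewrite !Cmult_conj, !Cpow_conj, !Cinv_conj, !Cconj_conj by assumption.
  rewrite !Cpow_inv by assumption.
  replace (Cpow z (pd1 P)) with (Cmult (Cpow z (pd1 P - i)) (Cpow z i)).
  replace (Cpow w (pd2 P)) with (Cmult (Cpow w (pd2 P - j)) (Cpow w j)).
  - assert (Cpow z i <> RtoC 0) by (apply Cpow_nz; assumption).
    assert (Cpow w j <> RtoC 0) by (apply Cpow_nz; assumption). Ceq; field. split; assumption.
  - rewrite <- Cpow_add_r. f_equal. lia.
  - rewrite <- Cpow_add_r. f_equal. lia.
Qed.

(** * Lipschitz functions on the closed bidisc *)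

(** The sup bound is included because the Lipschitz estimate of a product needs it. *)
Definition lip2 (F : C -> C -> C) : Prop :=
  exists K, 0 <= K /\
    (forall z w, Cmod z <= 1 -> Cmod w <= 1 -> Cmod (F z w) <= K) /\
    (forall z w z' w', Cmod z <= 1 -> Cmod w <= 1 -> Cmod z' <= 1 -> Cmod w' <= 1 ->
       Cmod (F z w - F z' w') <= K * (Cmod (z - z') + Cmod (w - w'))).

Lemma lip2_ext F G : (forall z w, F z w = G z w) -> lip2 F -> lip2 G.
Proof.
  intros H (K & HK & Hb & Hl). exists K. repeat split; [assumption| |]; intros;
  rewrite <- !H; auto.
Qed.

Lemma lip2_const c : lip2 (fun _ _ => c).
Proof.
  exists (Cmod c). assert (0 <= Cmod c) by apply Cmod_ge_0.
  repeat split; intros; [lra|lra|].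
  replace (c - c)%C with (RtoC 0) by ring. rewrite Cmod_0.
  apply Rmult_le_pos; [assumption|]. apply Rplus_le_le_0_compat; apply Cmod_ge_0.
Qed.

Lemma lip2_fst : lip2 (fun z _ => z).
Proof.
  exists 1. repeat split; intros; [lra|assumption|].
  generalize (Cmod_ge_0 (w - w')). lra.
Qed.

Lemma lip2_snd : lip2 (fun _ w => w).
Proof.
  exists 1. repeat split; intros; [lra|assumption|].
  generalize (Cmod_ge_0 (z - z')). lra.
Qed.

Lemma lip2_plus F G : lip2 F -> lip2 G -> lip2 (fun z w => Cplus (F z w) (G z w)).
Proof.
  intros (K & HK & Hb & Hl) (K' & HK' & Hb' & Hl').
  exists (K + K'). repeat split; intros; [lra| |].
  - eapply Rle_trans; [apply Cmod_triangle|]. apply Rplus_le_compat; auto.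
  - replace (F z w + G z w - (F z' w' + G z' w'))%C
      with ((F z w - F z' w') + (G z w - G z' w'))%C by ring.
    eapply Rle_trans; [apply Cmod_triangle|]. rewrite Rmult_plus_distr_r.
    apply Rplus_le_compat; auto.
Qed.

Lemma lip2_mult F G : lip2 F -> lip2 G -> lip2 (fun z w => Cmult (F z w) (G z w)).
Proof.
  intros (K & HK & Hb & Hl) (K' & HK' & Hb' & Hl').
  exists (2 * K * K'). repeat split; intros.
  - assert (0 <= K * K') by (apply Rmult_le_pos; assumption). lra.
  - rewrite Cmod_mult. assert (Cmod (F z w) * Cmod (G z w) <= K * K').
    { apply Rmult_le_compat; auto using Cmod_ge_0. }
    assert (0 <= K * K') by (apply Rmult_le_pos; assumption). lra.
  - replace (F z w * G z w - F z' w' * G z' w')%C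
      with ((F z w - F z' w') * G z w + F z' w' * (G z w - G z' w'))%C by ring.
    eapply Rle_trans; [apply Cmod_triangle|]. rewrite !Cmod_mult.
    set (d := Cmod (z - z') + Cmod (w - w')).
    assert (Cmod (F z w - F z' w') * Cmod (G z w) <= (K * d) * K').
    { apply Rmult_le_compat; auto using Cmod_ge_0. }
    assert (Cmod (F z' w') * Cmod (G z w - G z' w') <= K * (K' * d)).
    { apply Rmult_le_compat; auto using Cmod_ge_0. }
    lra.
Qed.

Lemma lip2_Cpow F n : lip2 F -> lip2 (fun z w => Cpow (F z w) n).
Proof.
  intros H. induction n as [|n IH]; simpl.
  - apply lip2_const.
  - apply (lip2_mult F); assumption.
Qed.

Lemma lip2_Csum n (F : nat -> C -> C -> C) :
  (forall i, lip2 (F i)) -> lip2 (fun z w => Csum n (fun i => F i z w)).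
Proof.
  intros H. induction n as [|n IH]; simpl.
  - apply (lip2_const C0).
  - apply (lip2_plus _ (F n)); auto.
Qed.

Lemma lip2_peval P : lip2 (peval P).
Proof.
  apply (lip2_ext _ _ (fun z w => eq_sym (peval_Csum P z w))).
  apply lip2_Csum; intros i. apply lip2_Csum; intros j.
  apply lip2_mult; [apply lip2_const|].
  apply lip2_mult; apply lip2_Cpow; [apply lip2_fst|apply lip2_snd].
Qed.

Lemma lip2_polyfun f : polyfun f -> lip2 (fun z _ => f z).
Proof.
  intros H; induction H;
    auto using lip2_const, lip2_fst, lip2_plus, lip2_mult.
Qed.

(* The bound is linear in d with a constant depending only on K and c: quotients of
   Lipschitz functions are Lipschitz where the denominator stays away from 0. *)
Lemma quotient_lipschitz (N N0 Q Q0 : C) (K c d : R) :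
  0 <= K -> 0 < c -> 0 <= d ->
  Cmod (N - N0) <= K * d -> Cmod (Q - Q0) <= K * d -> Cmod N0 <= K -> c <= Cmod Q0 ->
  K * d <= c / 2 ->
  Q <> RtoC 0 /\ Cmod (N / Q - N0 / Q0) <= (2 * K / c + 2 * K * K / (c * c)) * d.
Proof.
  intros HK Hc Hd HN HQ HN0 HQ0 Hs.
  assert (HQ1 : c / 2 <= Cmod Q).
  { generalize (Cmod_ge_sub Q0 Q). rewrite Cmod_sub_sym. lra. }
  assert (Qn : Q <> RtoC 0) by (intros E; rewrite E, Cmod_0 in HQ1; lra).
  assert (Q0n : Q0 <> RtoC 0) by (intros E; rewrite E, Cmod_0 in HQ0; lra).
  split; [assumption|].
  replace (N / Q - N0 / Q0)%C with (((N - N0) - (N0 / Q0) * (Q - Q0)) / Q)%C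
    by (field; split; assumption).
  rewrite Cmod_div by assumption.
  assert (A : Cmod (N - N0 - N0 / Q0 * (Q - Q0)) <= K * d + (K / c) * (K * d)).
  { eapply Rle_trans; [apply Cmod_minus_le|]. apply Rplus_le_compat; [assumption|].
    rewrite Cmod_mult. apply Rmult_le_compat; try apply Cmod_ge_0; [|assumption].
    rewrite Cmod_div by assumption. unfold Rdiv. apply Rmult_le_compat.
    - apply Cmod_ge_0.
    - apply Rlt_le, Rinv_0_lt_compat. lra.
    - assumption.
    - apply Rinv_le_contravar; lra. }
  apply Rle_trans with ((K * d + (K / c) * (K * d)) / (c / 2)).
  - unfold Rdiv at 1. unfold Rdiv at 3. apply Rmult_le_compat.
    + apply Cmod_ge_0.
    + apply Rlt_le, Rinv_0_lt_compat. lra.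
    + assumption.
    + apply Rinv_le_contravar; lra.
  - apply Req_le. field. lra.
Qed.

(** * Zeros on the boundary *)

(** The reversed slice is factored rather than the slice itself: it always has exactly m roots, and
    a drop of the degree of p(., w) merely shows as roots g = 0. *)
Lemma slice_factor P w : peval P (RtoC 0) w <> RtoC 0 ->
  exists l, length l = pd1 P /\
    (forall u, peval (preverse P) u w
               = (peval P (RtoC 0) w * prodC (fun g => (u - g)%C) l)%C) /\
    (forall z, peval P z w = (peval P (RtoC 0) w * prodC (fun g => (1 - g * z)%C) l)%C).
Proof.
  intros HL.
  destruct (FundamentalTheoremOfAlgebra.coeffs_factor
              (fun i => row (preverse P) i w) (pd1 P)) as (l & Hl & H).
  { change (row P (pd1 P - pd1 P) w <> RtoC 0). rewrite Nat.sub_diag, <- peval_0_l. exact HL. }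
  change (row (preverse P) (pd1 P) w) with (row P (pd1 P - pd1 P) w) in H.
  rewrite Nat.sub_diag, <- peval_0_l in H.
  assert (Hq : forall u, peval (preverse P) u w
               = (peval P (RtoC 0) w * prodC (fun g => (u - g)%C) l)%C).
  { intros u. rewrite peval_row. apply H. }
  exists l. split; [assumption|]. split; [exact Hq|].
  (* Reversal requires z to be nonzero; at z = 0 every factor equals 1. *)
  intros z. destruct (classic (z = RtoC 0)) as [->|Hz].
  - rewrite (prodC_ext _ (fun _ => (1 * 1)%C)).
    + rewrite prodC_scale, Cpow_1_l.
      replace (prodC (fun _ => RtoC 1) l) with (RtoC 1); [Ceq; ring|].
      clear. induction l as [|a l IH]; simpl; [reflexivity|]. rewrite <- IH. ring.
    + intros; ring.
  - rewrite peval_preverse by assumption. rewrite Hq.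
    rewrite <- Hl.
    replace (prodC (fun g => (1 - g * z)%C) l)
      with (prodC (fun g => (z * (/ z - g))%C) l).
    + rewrite (prodC_scale z (fun g => (/ z - g)%C)). Ceq; ring.
    + apply prodC_ext. intros g _. field. assumption.
Qed.

Lemma slice_roots_bounded P w l :
  peval P (RtoC 0) w <> RtoC 0 ->
  (forall z, peval P z w = (peval P (RtoC 0) w * prodC (fun g => (1 - g * z)%C) l)%C) ->
  (forall z, Cmod z < 1 -> peval P z w <> RtoC 0) ->
  forall g, In g l -> Cmod g <= 1.
Proof.
  intros HL H Hz g Hg. destruct (Rle_lt_dec (Cmod g) 1) as [|Hlt]; [assumption|exfalso].
  assert (Hg0 : g <> RtoC 0) by (intros E; rewrite E, Cmod_0 in Hlt; lra).
  apply (Hz (/ g)%C).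
  - rewrite Cmod_inv by assumption. rewrite <- Rinv_1. apply Rinv_lt_contravar; lra.
  - rewrite H. rewrite (prodC_zero _ g); [Ceq; ring|assumption|]. field. assumption.
Qed.

(** A Harnack inequality: each factor satisfies 1 - |z| <= |1 - g z| <= 2. The constants do not
    depend on w, which allows w to tend to the circle. *)
Lemma slice_harnack P w :
  (forall z, Cmod z < 1 -> peval P z w <> RtoC 0) ->
  forall z, Cmod z <= 1 ->
    Cmod (peval P (RtoC 0) w) * (1 - Cmod z) ^ pd1 P <= Cmod (peval P z w) /\
    Cmod (peval P z w) <= Cmod (peval P (RtoC 0) w) * 2 ^ pd1 P.
Proof.
  intros Hz z Hz1.
  assert (HL : peval P (RtoC 0) w <> RtoC 0) by (apply Hz; rewrite Cmod_0; lra).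
  destruct (slice_factor P w HL) as (l & Hl & _ & H).
  assert (Hg := slice_roots_bounded P w l HL H Hz).
  rewrite (H z), Cmod_mult, Cmod_prodC, <- Hl, <- !prodR_const.
  assert (B : forall g, In g l -> Cmod (g * z) <= Cmod z).
  { intros g Hin. rewrite Cmod_mult. generalize (Hg g Hin) (Cmod_ge_0 z). nra. }
  split; apply Rmult_le_compat_l; try apply Cmod_ge_0; apply prodR_le; intros g Hin;
    assert (Bg := B g Hin).
  - generalize (Cmod_one_minus (g * z)). lra.
  - split; [apply Cmod_ge_0|]. generalize (Cmod_minus_le 1 (g * z)). rewrite Cmod_1. lra.
Qed.

(** Makes the points e^{i/(k+1)} pairwise distinct, hence an infinite set on the circle. *)
Lemma cos_inv_succ_inj (i j : nat) :
  cos (/ INR (S i)) = cos (/ INR (S j)) -> i = j.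
Proof.
  intros H.
  assert (B : forall k, 0 < / INR (S k) <= 1).
  { intros k. assert (1 <= INR (S k)) by (rewrite S_INR; generalize (pos_INR k); lra).
    split; [apply Rinv_0_lt_compat; lra|]. rewrite <- Rinv_1. apply Rinv_le_contravar; lra. }
  assert (Hpi := PI_RGT_0). assert (Hp3 := PI2_1).
  assert (E : / INR (S i) = / INR (S j)).
  { generalize (B i) (B j); intros Bi Bj.
    destruct (Rtotal_order (/ INR (S i)) (/ INR (S j))) as [L|[L|L]]; [|assumption|];
      apply cos_decreasing_1 in L; lra. }
  apply Rinv_eq_reg in E. apply INR_eq in E. lia.
Qed.

Lemma no_list_contains_circle (L : list (C * C)) (w : C) :
  ~ (forall z, Cmod z = 1 -> In (z, w) L).
Proof.
  intros H.
  set (f := fun k : nat => (Cexpi (/ INR (S k)), w) : C * C).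
  assert (HN : NoDup (map f (seq 0 (S (length L))))).
  { apply NoDup_map_NoDup_ForallPairs; [|apply seq_NoDup].
    intros i j _ _ E. unfold f, Cexpi in E. inversion E. apply cos_inv_succ_inj; assumption. }
  assert (HI : incl (map f (seq 0 (S (length L)))) L).
  { intros x Hx. apply in_map_iff in Hx. destruct Hx as (k & <- & _).
    apply H. apply Cmod_Cexpi. }
  generalize (NoDup_incl_length HN HI). rewrite length_map, length_seq. lia.
Qed.

Lemma Cmod_dilate (r : R) (w : C) : 0 <= r -> Cmod (r * w) = r * Cmod w.
Proof. intros. rewrite Cmod_mult, Cmod_R, Rabs_pos_eq by assumption. reflexivity. Qed.

Lemma Cmod_dilate_sub (r : R) (w : C) : r <= 1 -> Cmod w <= 1 ->
  Cmod (r * w - w) <= 1 - r.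
Proof.
  intros Hr Hw. replace (r * w - w)%C with (RtoC (r - 1) * w)%C.
  - rewrite Cmod_mult, Cmod_R, Rabs_minus_sym, Rabs_pos_eq by lra.
    generalize (Cmod_ge_0 w). nra.
  - unfold Cminus. rewrite RtoC_minus. ring.
Qed.

(** A Hurwitz type argument: the slices at r w with r < 1 have no zero in the disc, so smallness at
    z0 spreads by Harnack to the closed disc. Then p(., w) vanishes on the whole circle, against the
    finiteness of the zeros on the torus. *)
Lemma no_zeros_D_times_T P : no_zeros_in_D2 P -> finitely_many_zeros_on_T2 P ->
  forall z w, Cmod z < 1 -> Cmod w = 1 -> peval P z w <> RtoC 0.
Proof.
  intros Hno (L & HL) z0 w Hz0 Hw H0.
  destruct (lip2_peval P) as (K & HK & _ & Hlip).
  assert (Hr : forall r, 0 <= r < 1 -> forall z, Cmod z < 1 -> peval P z (r * w)%C <> RtoC 0).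
  { intros r Hr z Hz. apply Hno. unfold inD2, inD. rewrite !Cnorm_Cmod. split; [exact Hz|].
    rewrite Cmod_dilate by lra. rewrite Hw. lra. }
  assert (D : forall e z, 0 < e <= 1 -> Cmod z <= 1 ->
              Cmod (peval P z ((1 - e)%R * w)%C - peval P z w) <= K * e).
  { intros e z He Hz. eapply Rle_trans; [apply Hlip; try lra|].
    - rewrite Cmod_dilate by lra. nra.
    - apply Rmult_le_compat_l; [assumption|].
      replace (z - z)%C with (RtoC 0) by ring. rewrite Cmod_0.
      generalize (Cmod_dilate_sub (1 - e) w). lra. }
  set (q := (1 - Cmod z0) ^ pd1 P).
  assert (Hq : 0 < q) by (apply pow_lt; lra).
  (* The lower Harnack bound at z0 turns the assumed zero into smallness at the centre; the upper
     bound then carries it to every z on the circle. *)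
  assert (U : forall e, 0 < e <= 1 -> Cmod (peval P (RtoC 0) ((1 - e)%R * w)%C) <= K / q * e).
  { intros e He. destruct (slice_harnack P ((1 - e)%R * w)%C) with (z := z0) as [H1 _].
    - apply Hr. lra.
    - lra.
    - fold q in H1. assert (H2 := D e z0 He (Rlt_le _ _ Hz0)). rewrite H0 in H2.
      replace (peval P z0 ((1 - e)%R * w)%C - 0)%C with (peval P z0 ((1 - e)%R * w)%C) in H2 by (Ceq; ring).
      apply Rmult_le_reg_r with q; [assumption|].
      replace (K / q * e * q) with (K * e) by (field; lra). lra. }
  apply (no_list_contains_circle L w). intros z Hz.
  apply HL; [split; unfold inT; rewrite Cnorm_Cmod; assumption|].
  apply Cmod_eq_0. apply Rle_antisym; [|apply Cmod_ge_0].
  apply Rle_of_forall_eps with (K := K + K / q * 2 ^ pd1 P). intros e He.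
  destruct (slice_harnack P ((1 - e)%R * w)%C) with (z := z) as [_ H1].
  - apply Hr. lra.
  - lra.
  - assert (H2 := D e z He (Req_le _ _ Hz)).
    rewrite Cmod_sub_sym in H2.
    generalize (Cmod_ge_sub (peval P z w) (peval P z ((1 - e)%R * w)%C)). intros H3.
    assert (Cmod (peval P (RtoC 0) ((1 - e)%R * w)%C) * 2 ^ pd1 P <= K / q * e * 2 ^ pd1 P).
    { apply Rmult_le_compat_r; [apply pow_le; lra|auto]. }
    lra.
Qed.

(** * The polynomial that selects one root *)

Lemma prodR_exchange (f : C -> C -> R) l1 l2 :
  prodR (fun a => prodR (fun b => f a b) l2) l1
  = prodR (fun b => prodR (fun a => f a b) l1) l2.
Proof.
  induction l1 as [|a l1 IH]; simpl.
  - rewrite prodR_const. symmetry. apply pow1.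
  - rewrite IH, <- prodR_mult. reflexivity.
Qed.

Lemma prodC_nonzero (h : C -> C) l :
  (forall a, In a l -> h a <> RtoC 0) -> prodC h l <> RtoC 0.
Proof.
  induction l as [|a l IH]; simpl; intros H.
  - intros E. apply RtoC_inj in E. lra.
  - apply Cmult_neq_0; auto.
Qed.

(** N is the multiplicity of s in [l], possibly 0, and [l1] lists the other roots. *)
Lemma split_root (s : C) l :
  exists N l1, ~ In s l1 /\ (forall a, In a l -> a = s \/ In a l1) /\
    forall u, prodC (fun a => (u - a)%C) l
              = (Cpow (u - s) N * prodC (fun a => (u - a)%C) l1)%C.
Proof.
  induction l as [|a l (N & l1 & H1 & H2 & H3)].
  - exists O, nil. simpl. repeat split; try tauto. intros; ring.
  - destruct (classic (a = s)) as [E|E].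
    + subst a. exists (S N), l1. repeat split; [assumption| |].
      * intros x [Hx|Hx]; [left; congruence|auto].
      * intros u. simpl. rewrite H3. ring.
    + exists N, (a :: l1). repeat split.
      * simpl. intros [F|F]; [congruence|tauto].
      * intros x [Hx|Hx]; [right; left; assumption|].
        destruct (H2 x Hx); [left|right; right]; assumption.
      * intros u. simpl. rewrite H3. ring.
Qed.

Lemma polyfun_comp f g : polyfun f -> polyfun g -> polyfun (fun z => f (g z)).
Proof.
  intros Hf Hg. induction Hf.
  - apply polyfun_const.
  - assumption.
  - apply (polyfun_plus (fun z => f (g z))); assumption.
  - apply (polyfun_mult (fun z => f (g z))); assumption.
Qed.

Lemma polyfun_minus f g : polyfun f -> polyfun g -> polyfun (fun z => (f z - g z)%C).
Proof.
  intros Hf Hg.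
  assert (H : polyfun (fun z => (f z + RtoC (-1) * g z)%C)).
  { apply polyfun_plus; [assumption|]. apply polyfun_mult; [apply polyfun_const|assumption]. }
  replace (fun z => (f z - g z)%C) with (fun z => (f z + RtoC (-1) * g z)%C); [assumption|].
  apply FunctionalExtensionality.functional_extensionality. intros z.
  ring.
Qed.

Lemma polyfun_Cpow f n : polyfun f -> polyfun (fun z => Cpow (f z) n).
Proof.
  intros H. induction n as [|n IH]; simpl; [apply polyfun_const|].
  apply (polyfun_mult f); assumption.
Qed.

Lemma polyfun_prod_roots l : polyfun (fun z => prodC (fun a => (z - a)%C) l).
Proof.
  induction l as [|a l IH]; simpl; [apply polyfun_const|].
  apply (polyfun_mult (fun z => (z - a)%C)); [|assumption].
  apply polyfun_minus; [apply polyfun_id|apply polyfun_const].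
Qed.

(** Applied to x = b(u)^2, it shows that G - 1 is divisible by b^2. *)
Lemma one_minus_pow_factor M :
  exists k, polyfun k /\ forall x, (1 - Cpow (1 - x) M = x * k x)%C.
Proof.
  induction M as [|M (k & Hk & H)].
  - exists (fun _ => RtoC 0). split; [apply polyfun_const|]. intros; simpl; ring.
  - exists (fun x => (1 + (1 - x) * k x)%C). split.
    + apply polyfun_plus; [apply polyfun_const|]. apply polyfun_mult; [|assumption].
      apply polyfun_minus; [apply polyfun_const|apply polyfun_id].
    + intros x. simpl.
      replace (1 - (1 - x) * Cpow (1 - x) M)%C
        with (x + (1 - x) * (1 - Cpow (1 - x) M))%C by ring.
      rewrite H. ring.
Qed.

Lemma Cmod_pow2n (x : C) N : Cmod (Cpow x (2 * N)) = (Cmod x ^ N) ^ 2.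
Proof. rewrite Cmod_pow, <- pow_mult. f_equal. lia. Qed.

(* G equals [conj s * u] to high order at s and 1 to high order at the other roots;
   a perturbed root u satisfies |q(u)| = O(t), so the error terms below are O(t^2). *)
Lemma root_selector (L0 s : C) (l : list C) : L0 <> RtoC 0 -> Cmod s = 1 ->
  exists G K d, polyfun G /\ 0 <= K /\ 0 < d /\
    (forall a, In a l -> G a = RtoC 1) /\
    (forall u, Cmod u <= 1 ->
       Cmod (G u) <= 1 + K * Cmod (L0 * prodC (fun a => (u - a)%C) l) ^ 2) /\
    (forall u, Cmod u <= 1 -> Cmod (u - s) <= d ->
       Cmod (G u) <= Cmod u + K * Cmod (L0 * prodC (fun a => (u - a)%C) l) ^ 2).
Proof.
  intros HL Hs.
  assert (Hs0 : s <> RtoC 0) by (intros E; rewrite E, Cmod_0 in Hs; lra).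
  destruct (split_root s l) as (N & l1 & H1 & H2 & H3).
  set (B := fun u => prodC (fun a => (u - a)%C) l1).
  assert (HB : B s <> RtoC 0).
  { apply prodC_nonzero. intros a Ha E. apply H1.
    replace s with a; [assumption|]. replace s with (s - a + a)%C by ring. rewrite E. ring. }
  (* b is 1 at s and 0 at the other roots. Below, h = 1 - b^2 is 0 at s and differs from 1 by b^2
     only. *)
  set (b := fun u => (/ B s * B u)%C).
  assert (Pb : polyfun b).
  { apply polyfun_mult; [apply polyfun_const|apply polyfun_prod_roots]. }
  assert (bs : b s = RtoC 1) by (unfold b; field; assumption).
  assert (bz : forall a, In a l1 -> b a = RtoC 0).
  { intros a Ha. unfold b, B. rewrite (prodC_zero (fun x => (a - x)%C) a l1 Ha) by ring. ring. }
  set (h := fun u => (1 - b u * b u)%C).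
  assert (Ph : polyfun h).
  { apply polyfun_minus; [apply polyfun_const|apply polyfun_mult; assumption]. }
  (* Interpolation between u / s, where h is small, and 1, where h is close to 1. The exponent 2 N
     makes h^(2 N) = O(|u - s|^(2 N)), which near s is of the order of |q(u)|^2 because N is the
     multiplicity of s. *)
  set (G := fun u => (/ s * u + (1 - / s * u) * Cpow (h u) (2 * N))%C).
  assert (PG : polyfun G).
  { assert (polyfun (fun u => (/ s * u)%C))
      by (apply polyfun_mult; [apply polyfun_const|apply polyfun_id]).
    apply polyfun_plus; [assumption|]. apply polyfun_mult; [|apply polyfun_Cpow; assumption].
    apply polyfun_minus; [apply polyfun_const|assumption]. }
  destruct (lip2_polyfun b Pb) as (Kb & HKb & _ & Lb).
  destruct (lip2_polyfun h Ph) as (Kh & HKh & _ & Lh).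
  destruct (one_minus_pow_factor (2 * N)) as (k & Pk & Hk).
  assert (Pkb : polyfun (fun u => k (b u * b u)%C)).
  { apply (polyfun_comp k); [assumption|apply polyfun_mult; assumption]. }
  destruct (lip2_polyfun _ Pkb) as (Kk & HKk & Bk & _).
  set (beta := Cmod (L0 * B s)).
  assert (Hbeta : 0 < beta) by (apply Cmod_gt_0, Cmult_neq_0; assumption).
  assert (Hq : forall u, Cmod (L0 * prodC (fun a => (u - a)%C) l)
                         = Cmod (u - s) ^ N * Cmod (b u) * beta).
  { intros u. rewrite H3. fold (B u). unfold beta.
    replace (L0 * (Cpow (u - s) N * B u))%C with (Cpow (u - s) N * b u * (L0 * B s))%C
      by (unfold b; field; assumption).
    rewrite !Cmod_mult, Cmod_pow. reflexivity. }
  assert (Hsi : forall u, Cmod (/ s * u) = Cmod u).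
  { intros u. rewrite Cmod_mult, Cmod_inv, Hs by assumption. field. }
  assert (H1s : forall u, Cmod u <= 1 -> Cmod (1 - / s * u) <= 2).
  { intros u Hu. eapply Rle_trans; [apply Cmod_minus_le|]. rewrite Hsi, Cmod_1. lra. }
  (* By the Lipschitz bound Kb, b moves by at most 1/2 from b(s) = 1 within distance sig of s. *)
  set (sig := / (2 * (Kb + 1))).
  assert (Hsig : 0 < sig) by (apply Rinv_0_lt_compat; lra).
  assert (HsN : 0 < sig ^ N) by (apply pow_lt; assumption).
  assert (Lbs : forall u, Cmod u <= 1 -> Cmod (u - s) <= sig -> 1 / 2 <= Cmod (b u)).
  { intros u Hu Hd. assert (A := Lb u (RtoC 0) s (RtoC 0) Hu).
    rewrite Cmod_0, Hs in A. specialize (A ltac:(lra) ltac:(lra) ltac:(lra)).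
    replace (0 - 0)%C with (RtoC 0) in A by ring. rewrite Cmod_0, bs, Rplus_0_r in A.
    assert (A2 : Kb * Cmod (u - s) <= (Kb + 1) * sig).
    { generalize (Cmod_ge_0 (u - s)). intros. apply Rmult_le_compat; lra. }
    unfold sig in A2. replace ((Kb + 1) * / (2 * (Kb + 1))) with (1 / 2) in A2 by (field; lra).
    generalize (Cmod_one_minus (1 - b u)). replace (1 - (1 - b u))%C with (b u) by ring.
    rewrite (Cmod_sub_sym 1 (b u)). lra. }
  (* 2 bounds |1 - u/s|, Kh comes from |h(u)| <= Kh |u - s|, and 4 / beta^2 from |b| >= 1/2 in |q| =
     |u - s|^N |b| beta. *)
  set (K1 := 2 * (Kh ^ N) ^ 2 * (4 / (beta ^ 2))).
  assert (HK1 : 0 <= K1).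
  { unfold K1. apply Rmult_le_pos; [apply Rmult_le_pos; [lra|apply pow2_ge_0]|].
    apply Rlt_le, Rdiv_lt_0_compat; [lra|]. apply pow_lt; assumption. }
  assert (Near : forall u, Cmod u <= 1 -> 1 / 2 <= Cmod (b u) ->
       Cmod (G u) <= Cmod u + K1 * Cmod (L0 * prodC (fun a => (u - a)%C) l) ^ 2).
  { intros u Hu Hb. unfold G. eapply Rle_trans; [apply Cmod_triangle|].
    rewrite Hsi. apply Rplus_le_compat_l. rewrite Cmod_mult, Cmod_pow2n, Hq.
    assert (A : Cmod (h u) <= Kh * Cmod (u - s)).
    { assert (A := Lh u (RtoC 0) s (RtoC 0) Hu).
      rewrite Cmod_0, Hs in A. specialize (A ltac:(lra) ltac:(lra) ltac:(lra)).
      replace (0 - 0)%C with (RtoC 0) in A by ring. rewrite Cmod_0, Rplus_0_r in A.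
      replace (h s) with (RtoC 0) in A by (unfold h; rewrite bs; ring).
      replace (h u - 0)%C with (h u) in A by ring. exact A. }
    assert (A2 : Cmod (h u) ^ N <= Kh ^ N * Cmod (u - s) ^ N).
    { rewrite <- Rpow_mult_distr. apply pow_incr. split; [apply Cmod_ge_0|assumption]. }
    set (x := Cmod (h u) ^ N) in *. set (y := Cmod (u - s) ^ N) in *.
    assert (0 <= x) by (apply pow_le, Cmod_ge_0). assert (0 <= y) by (apply pow_le, Cmod_ge_0).
    assert (A3 : x ^ 2 <= (Kh ^ N * y) ^ 2) by (apply pow_incr; lra).
    assert (A4 : (y * (1 / 2)) ^ 2 <= (y * Cmod (b u)) ^ 2).
    { apply pow_incr. split; [lra|]. apply Rmult_le_compat_l; assumption. }
    apply Rle_trans with (2 * (Kh ^ N * y) ^ 2).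
    - apply Rmult_le_compat; auto using Cmod_ge_0, pow2_ge_0.
    - replace (2 * (Kh ^ N * y) ^ 2) with (8 * (Kh ^ N) ^ 2 * (y * (1 / 2)) ^ 2) by field.
      replace (K1 * (y * Cmod (b u) * beta) ^ 2) with (8 * (Kh ^ N) ^ 2 * (y * Cmod (b u)) ^ 2)
        by (unfold K1; field; lra).
      apply Rmult_le_compat_l; [|assumption].
      apply Rmult_le_pos; [lra|apply pow2_ge_0]. }
  set (K2 := 2 * Kk / (sig ^ N * beta) ^ 2).
  assert (HK2 : 0 <= K2).
  { unfold K2. apply Rmult_le_pos; [lra|]. apply Rlt_le, Rinv_0_lt_compat, pow_lt.
    apply Rmult_lt_0_compat; assumption. }
  assert (Hq2 : forall u, 0 <= Cmod (L0 * prodC (fun a => (u - a)%C) l) ^ 2)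
    by (intros; apply pow2_ge_0).
  exists G, (K1 + K2), sig. split; [assumption|]. split; [lra|]. split; [assumption|].
  assert (Gs : G s = RtoC 1) by (unfold G; field; assumption).
  split; [|split].
  - intros a Ha. destruct (H2 a Ha) as [->|Ha1]; [assumption|].
    unfold G, h. rewrite (bz a Ha1). replace (1 - 0 * 0)%C with (RtoC 1) by ring.
    rewrite Cpow_1_l. ring.
  (* If |b(u)| >= 1/2 the bound [Near] holds, wherever u lies. Otherwise u is at distance at least
     sig from s, so |q(u)| >= sig^N |b(u)| beta absorbs G - 1 = O(b^2). *)
  - intros u Hu. destruct (Rle_lt_dec (1 / 2) (Cmod (b u))) as [Hb|Hb].
    + eapply Rle_trans; [apply Near; assumption|].
      assert (A := Rmult_le_pos _ _ HK2 (Hq2 u)). rewrite Rmult_plus_distr_r. lra.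
    + assert (Hd : sig <= Cmod (u - s)).
      { destruct (Rle_lt_dec sig (Cmod (u - s))) as [|Hlt]; [assumption|].
        assert (A := Lbs u Hu (Rlt_le _ _ Hlt)). lra. }
      assert (HG : G u = (1 - (1 - / s * u) * (b u * b u) * k (b u * b u))%C).
      { unfold G, h.
        replace (/ s * u + (1 - / s * u) * (1 - b u * b u) ^ (2 * N))%C
          with (1 - (1 - / s * u) * (1 - (1 - b u * b u) ^ (2 * N)))%C by ring.
        rewrite Hk. ring. }
      rewrite HG. eapply Rle_trans; [apply Cmod_minus_le|]. rewrite Cmod_1.
      apply Rplus_le_compat_l. rewrite Hq, !Cmod_mult.
      assert (A1 := Bk u (RtoC 0) Hu ltac:(rewrite Cmod_0; lra)). cbv beta in A1.
      assert (A2 : sig ^ N <= Cmod (u - s) ^ N) by (apply pow_incr; lra).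
      assert (A3 : Cmod (1 - / s * u) * (Cmod (b u) * Cmod (b u)) * Cmod (k (b u * b u)%C)
                   <= 2 * (Cmod (b u) * Cmod (b u)) * Kk).
      { assert (0 <= Cmod (b u) * Cmod (b u)) by (apply Rmult_le_pos; apply Cmod_ge_0).
        apply Rmult_le_compat; auto using Cmod_ge_0.
        - apply Rmult_le_pos; auto using Cmod_ge_0.
        - apply Rmult_le_compat_r; auto. }
      eapply Rle_trans; [exact A3|]. 
      assert (A4 : (sig ^ N * Cmod (b u) * beta) ^ 2 <= (Cmod (u - s) ^ N * Cmod (b u) * beta) ^ 2).
      { assert (0 <= Cmod (b u)) by apply Cmod_ge_0.
        apply pow_incr. split.
        - apply Rmult_le_pos; [apply Rmult_le_pos|]; lra.
        - apply Rmult_le_compat_r; [lra|]. apply Rmult_le_compat_r; assumption. }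
      apply Rle_trans with (K2 * (sig ^ N * Cmod (b u) * beta) ^ 2).
      * unfold K2. apply Req_le. field. lra.
      * apply Rle_trans with (K2 * (Cmod (u - s) ^ N * Cmod (b u) * beta) ^ 2).
        -- apply Rmult_le_compat_l; assumption.
        -- apply Rmult_le_compat_r; [apply pow2_ge_0|lra].
  - intros u Hu Hd. eapply Rle_trans; [apply Near; auto|].
    assert (A := Rmult_le_pos _ _ HK2 (Hq2 u)). rewrite Rmult_plus_distr_r. lra.
Qed.

(** * Functions with a first order expansion and quadratic remainder at 0 *)

Definition expandable (F : R -> C) : Prop :=
  exists (a b : C) (K : R), 0 <= K /\
    forall t, Rabs t <= 1 -> Cmod (F t - (a + t * b)) <= K * t ^ 2.

Lemma expandable_ext F G : (forall t, F t = G t) -> expandable F -> expandable G.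
Proof.
  intros H (a & b & K & HK & HF). exists a, b, K. split; [assumption|].
  intros t Ht. rewrite <- H. auto.
Qed.

Lemma expandable_const c : expandable (fun _ => c).
Proof.
  exists c, (RtoC 0), 0. split; [lra|]. intros t _.
  replace (c - (c + t * 0))%C with (RtoC 0) by ring. rewrite Cmod_0. lra.
Qed.

Lemma expandable_plus F G :
  expandable F -> expandable G -> expandable (fun t => Cplus (F t) (G t)).
Proof.
  intros (a & b & K & HK & HF) (a' & b' & K' & HK' & HG).
  exists (a + a')%C, (b + b')%C, (K + K'). split; [lra|]. intros t Ht.
  replace (F t + G t - (a + a' + t * (b + b')))%C
    with ((F t - (a + t * b)) + (G t - (a' + t * b')))%C by ring.
  eapply Rle_trans; [apply Cmod_triangle|]. rewrite Rmult_plus_distr_r.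
  apply Rplus_le_compat; auto.
Qed.

Lemma sq_le_1 t : Rabs t <= 1 -> 0 <= t ^ 2 <= 1.
Proof.
  intros Ht. rewrite <- pow2_abs. generalize (Rabs_pos t). intros. split; [apply pow2_ge_0|].
  rewrite <- (pow1 2). apply pow_incr. lra.
Qed.

Lemma Cmod_affine_le (a b : C) t : Rabs t <= 1 -> Cmod (a + t * b) <= Cmod a + Cmod b.
Proof.
  intros Ht. eapply Rle_trans; [apply Cmod_triangle|]. apply Rplus_le_compat_l.
  rewrite Cmod_mult, Cmod_R. generalize (Cmod_ge_0 b). nra.
Qed.

Lemma expandable_bounded F : expandable F ->
  exists K, 0 <= K /\ forall t, Rabs t <= 1 -> Cmod (F t) <= K.
Proof.
  intros (a & b & K & HK & HF). exists (K + (Cmod a + Cmod b)). split.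
  - generalize (Cmod_ge_0 a) (Cmod_ge_0 b). lra.
  - intros t Ht. assert (H1 := HF t Ht). assert (H2 := Cmod_affine_le a b t Ht).
    assert (H3 := sq_le_1 t Ht).
    generalize (Cmod_ge_sub (F t) (a + t * b)). nra.
Qed.

Lemma expandable_mult F G :
  expandable F -> expandable G -> expandable (fun t => Cmult (F t) (G t)).
Proof.
  intros (a & b & K & HK & HF) HG0.
  destruct (expandable_bounded G HG0) as (M & HM & BG).
  destruct HG0 as (a' & b' & K' & HK' & HG).
  assert (Ha := Cmod_ge_0 a). assert (Hb := Cmod_ge_0 b). assert (Hb' := Cmod_ge_0 b').
  exists (a * a')%C, (a * b' + b * a')%C, (K * M + (Cmod a + Cmod b) * K' + Cmod b * Cmod b').
  split.
  { assert (0 <= K * M) by (apply Rmult_le_pos; assumption).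
    assert (0 <= (Cmod a + Cmod b) * K') by (apply Rmult_le_pos; lra).
    assert (0 <= Cmod b * Cmod b') by (apply Rmult_le_pos; assumption). lra. }
  intros t Ht. assert (Hsq := sq_le_1 t Ht).
  replace (F t * G t - (a * a' + t * (a * b' + b * a')))%C
    with ((F t - (a + t * b)) * G t + (a + t * b) * (G t - (a' + t * b'))
          + (t * t) * (b * b'))%C by ring.
  eapply Rle_trans; [apply Cmod_triangle|].
  rewrite !Rmult_plus_distr_r. apply Rplus_le_compat.
  - eapply Rle_trans; [apply Cmod_triangle|]. rewrite !Cmod_mult. apply Rplus_le_compat.
    + replace (K * M * t ^ 2) with ((K * t ^ 2) * M) by ring.
      apply Rmult_le_compat; auto using Cmod_ge_0.
    + replace (Cmod a * K' * t ^ 2 + Cmod b * K' * t ^ 2)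
        with ((Cmod a + Cmod b) * (K' * t ^ 2)) by ring.
      apply Rmult_le_compat; auto using Cmod_ge_0, Cmod_affine_le.
  - rewrite !Cmod_mult, Cmod_R. rewrite <- (pow2_abs t). apply Req_le. ring.
Qed.

Lemma expandable_conj F : expandable F -> expandable (fun t => Cconj (F t)).
Proof.
  intros (a & b & K & HK & HF). exists (Cconj a), (Cconj b), K. split; [assumption|].
  intros t Ht.
  replace (Cconj (F t) - (Cconj a + t * Cconj b))%C with (Cconj (F t - (a + t * b))).
  - rewrite Cmod_conj. auto.
  - rewrite Cminus_conj, Cplus_conj, Cmult_conj. do 3 f_equal.
    unfold Cconj, RtoC; simpl. f_equal. ring.
Qed.

Lemma expandable_Cmod2 F : expandable F -> expandable (fun t => RtoC (Cmod (F t) ^ 2)).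
Proof.
  intros HF. apply (expandable_ext (fun t => (F t * Cconj (F t))%C)).
  - intros t. symmetry. apply Cmod2_conj.
  - apply expandable_mult; [|apply expandable_conj]; assumption.
Qed.

Lemma expandable_Cpow F n : expandable F -> expandable (fun t => Cpow (F t) n).
Proof.
  intros H. induction n as [|n IH]; simpl; [apply expandable_const|].
  apply (expandable_mult F); assumption.
Qed.

Lemma expandable_Csum n (F : nat -> R -> C) :
  (forall i, expandable (F i)) -> expandable (fun t => Csum n (fun i => F i t)).
Proof.
  intros H. induction n as [|n IH]; simpl; [apply (expandable_const C0)|].
  apply (expandable_plus _ (F n)); auto.
Qed.

Lemma expandable_peval P z w : expandable z -> expandable w ->
  expandable (fun t => peval P (z t) (w t)).
Proof.
  intros Hz Hw. apply (expandable_ext _ _ (fun t => eq_sym (peval_Csum P (z t) (w t)))).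
  apply expandable_Csum; intros i. apply expandable_Csum; intros j.
  apply expandable_mult; [apply expandable_const|].
  apply expandable_mult; apply expandable_Cpow; assumption.
Qed.

Lemma expandable_prodR (F : C -> R -> R) l :
  (forall a, expandable (fun t => RtoC (F a t))) ->
  expandable (fun t => RtoC (prodR (fun a => F a t) l)).
Proof.
  intros H. induction l as [|a l IH]; simpl; [apply expandable_const|].
  apply (expandable_ext (fun t => (RtoC (F a t) * RtoC (prodR (fun b => F b t) l))%C)).
  - intros t. symmetry. apply RtoC_mult.
  - apply expandable_mult; auto.
Qed.

Lemma abs_sin_le x : Rabs (sin x) <= Rabs x.
Proof.
  assert (A : forall y, 0 <= y -> Rabs (sin y) <= y).
  { intros y Hy. destruct (Req_dec y 0) as [->|Hn]; [rewrite sin_0, Rabs_R0; lra|].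
    assert (sin y < y) by (apply sin_lt_x; lra).
    unfold Rabs. destruct (Rcase_abs (sin y)) as [Hs|]; [|lra].
    destruct (Rle_lt_dec y PI) as [Hp|Hp].
    - generalize (sin_ge_0 y Hy Hp). lra.
    - generalize (SIN_bound y) PI2_1 PI_RGT_0. lra. }
  destruct (Rle_lt_dec 0 x).
  - rewrite (Rabs_pos_eq x) by assumption. auto.
  - rewrite (Rabs_left x), <- Rabs_Ropp, <- sin_neg by lra. apply A. lra.
Qed.

Lemma Cexpi_0 : Cexpi 0 = RtoC 1.
Proof. unfold Cexpi. rewrite cos_0, sin_0. reflexivity. Qed.

Lemma one_minus_cos_bounds t : 0 <= 1 - cos t <= t ^ 2 / 2.
Proof.
  replace t with (2 * (t / 2)) at 1 2 by field. rewrite cos_2a_sin.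
  assert (H := abs_sin_le (t / 2)).
  assert (H2 : Rsqr (sin (t / 2)) <= Rsqr (t / 2)) by (apply Rsqr_le_abs_1; assumption).
  unfold Rsqr in H2. split; nra.
Qed.

Lemma Cmod_Cexpi_sub t : Cmod (Cexpi t - 1) <= Rabs t.
Proof.
  apply Rsqr_incr_0; [|apply Cmod_ge_0|apply Rabs_pos].
  rewrite !Rsqr_pow2, Cmod_sqr, pow2_abs. simpl.
  generalize (one_minus_cos_bounds t) (sin2_cos2 t). unfold Rsqr. simpl. nra.
Qed.

Lemma expandable_Cexpi : expandable Cexpi.
Proof.
  exists (RtoC 1), Ci, 2. split; [lra|]. intros t Ht.
  replace (Cexpi t - (1 + t * Ci))%C with ((cos t - 1, sin t - t) : C)
    by (unfold Cexpi, Cminus, Cplus, Cmult, Copp, RtoC, Ci; simpl; f_equal; ring).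
  assert (A := one_minus_cos_bounds t).
  assert (B : Rabs (sin t - t) <= t ^ 2).
  (* sin t - t = (cos c - 1) t with c between 0 and t, which is even of third order. *)
  { destruct (MVT_gen (fun x => sin x - x) 0 t (fun x => cos x - 1)) as (c & Hc & E).
    - intros x _. auto_derive; [trivial|ring].
    - intros x _. apply continuity_pt_filterlim.
      apply (ex_derive_continuous (fun x => sin x - x) x). auto_derive. trivial.
    - rewrite sin_0 in E. replace (sin t - t) with ((cos c - 1) * t) by lra.
      rewrite Rabs_mult.
      assert (Hct : c ^ 2 <= t ^ 2).
      { unfold Rmin, Rmax in Hc. destruct (Rle_dec 0 t); nra. }
      assert (B1 := one_minus_cos_bounds c).
      rewrite Rabs_minus_sym, Rabs_pos_eq by lra.
      assert (S := sq_le_1 t Ht). generalize (Rabs_pos t). intros. nra. }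
  apply Rle_trans with (Rabs (cos t - 1) + Rabs (sin t - t)).
  - apply Rsqr_incr_0; [|apply Cmod_ge_0|generalize (Rabs_pos (cos t - 1)) (Rabs_pos (sin t - t)); lra].
    rewrite !Rsqr_pow2, Cmod_sqr. simpl fst; simpl snd.
    assert (E1 := pow2_abs (cos t - 1)). assert (E2 := pow2_abs (sin t - t)).
    generalize (Rabs_pos (cos t - 1)) (Rabs_pos (sin t - t)). nra.
  - rewrite (Rabs_minus_sym (cos t)), (Rabs_pos_eq (1 - cos t)) by lra. lra.
Qed.

(* First derivative test: w(0) = 0 and w >= -O(t^2) on both sides kill the linear term. *)
Lemma expandable_min (w : R -> R) M : expandable (fun t => RtoC (w t)) -> 0 <= M ->
  w 0 = 0 -> (forall t, Rabs t <= 1 -> - M * t ^ 2 <= w t) ->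
  exists K, 0 <= K /\ forall t, Rabs t <= 1 -> w t <= K * t ^ 2.
Proof.
  intros (a & b & K & HK & H) HM H0 Hlow.
  assert (R1 : forall t, Rabs t <= 1 -> Rabs (w t - (fst a + t * fst b)) <= K * t ^ 2).
  { intros t Ht. eapply Rle_trans; [|apply (H t Ht)].
    replace (w t - (fst a + t * fst b)) with (Re (RtoC (w t) - (a + t * b))%C).
    - apply Rle_trans with (Rmax (Rabs (fst (RtoC (w t) - (a + t * b))%C))
                                 (Rabs (snd (RtoC (w t) - (a + t * b))%C))).
      + apply Rmax_l.
      + apply Rmax_Cmod.
    - simpl. ring. }
  assert (Ha : fst a = 0).
  { assert (A := R1 0). rewrite Rabs_R0, H0 in A. specialize (A ltac:(lra)).
    replace (0 - (fst a + 0 * fst b)) with (- fst a) in A by ring.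
    rewrite Rabs_Ropp in A. generalize (Rabs_pos (fst a)). intros.
    assert (Rabs (fst a) = 0) by nra. apply Rabs_eq_0; assumption. }
  assert (Hb : Rabs (fst b) <= 0).
  { apply Rle_of_forall_eps with (K := M + K). intros e He.
    assert (A1 := R1 e ltac:(rewrite Rabs_pos_eq; lra)).
    assert (A2 := R1 (- e) ltac:(rewrite Rabs_Ropp, Rabs_pos_eq; lra)).
    assert (L1 := Hlow e ltac:(rewrite Rabs_pos_eq; lra)).
    assert (L2 := Hlow (- e) ltac:(rewrite Rabs_Ropp, Rabs_pos_eq; lra)).
    rewrite Ha in *.
    apply Rabs_le_between in A1. apply Rabs_le_between in A2.
    apply Rmult_le_reg_l with e; [lra|].
    assert (B1 : e * fst b <= e * ((M + K) * e)) by nra.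
    assert (B2 : e * - fst b <= e * ((M + K) * e)) by nra.
    unfold Rabs; destruct (Rcase_abs (fst b)); assumption. }
  assert (Hb0 : fst b = 0) by (apply Rabs_eq_0; generalize (Rabs_pos (fst b)); lra).
  exists K. split; [assumption|]. intros t Ht.
  assert (A := R1 t Ht). rewrite Ha, Hb0 in A. apply Rabs_le_between in A. lra.
Qed.

(** Keeps a product of m factors 1 + O(t^2) of the form 1 + O(t^2). *)
Lemma one_plus_pow_le (M : nat) (X : R) : 0 <= X ->
  exists K, 0 <= K /\ forall x, 0 <= x <= X -> (1 + x) ^ M <= 1 + K * x.
Proof.
  intros HX. induction M as [|M (K & HK & H)].
  - exists 0. split; [lra|]. intros; simpl; lra.
  - exists (1 + K + K * X). split; [nra|]. intros x Hx. simpl.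
    assert (A := H x Hx). assert (0 <= K * x) by nra.
    apply Rle_trans with ((1 + x) * (1 + K * x)); [apply Rmult_le_compat_l; lra|]. nra.
Qed.

(** * A root of the slices at distance O(t^2) from the circle *)

(** Both sides equal |c|^m |Lw|^D times the double product of |g - a|, with m and D the lengths of
    [l] and [rho]: the modulus of the resultant of G and the reversed slice, read from either set of
    roots. *)
Lemma resultant_identity (G : C -> C) (c Lw : C) (rho l : list C) :
  (forall z, G z = (c * prodC (fun a => (z - a)%C) rho)%C) ->
  Cmod Lw ^ length rho * prodR (fun g => Cmod (G g)) l
  = Cmod c ^ length l * prodR (fun a => Cmod (Lw * prodC (fun g => (a - g)%C) l)) rho.
Proof.
  intros HG.
  rewrite (prodR_ext (fun g => Cmod (G g))
             (fun g => Cmod c * prodR (fun a => Cmod (g - a)) rho)).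
  2:{ intros g _. rewrite HG, Cmod_mult, Cmod_prodC. reflexivity. }
  rewrite (prodR_ext (fun a => Cmod (Lw * prodC (fun g => (a - g)%C) l))
             (fun a => Cmod Lw * prodR (fun g => Cmod (g - a)) l)).
  2:{ intros a _. rewrite Cmod_mult, Cmod_prodC. f_equal. apply prodR_ext.
      intros; apply Cmod_sub_sym. }
  rewrite !prodR_mult, !prodR_const, (prodR_exchange (fun g a => Cmod (g - a))). ring.
Qed.

Lemma boundary_root_quadratic P (tau1 tau2 : C) :
  no_zeros_in_D2 P -> finitely_many_zeros_on_T2 P ->
  Cmod tau1 = 1 -> Cmod tau2 = 1 -> peval P tau1 tau2 = RtoC 0 ->
  exists K t0, 0 <= K /\ 0 < t0 <= 1 /\ forall t, Rabs t <= t0 ->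
    exists l g, length l = pd1 P /\
      (forall z, peval P z (tau2 * Cexpi t)%C = (peval P (RtoC 0) (tau2 * Cexpi t)%C
                   * prodC (fun a => (1 - a * z)%C) l)%C) /\
      (forall a, In a l -> Cmod a <= 1) /\ In g l /\ 1 - K * t ^ 2 <= Cmod g.
Proof.
  intros Hno Hfin Ht1 Ht2 H0.
  set (w := fun t => (tau2 * Cexpi t)%C).
  assert (Hw : forall t, Cmod (w t) = 1).
  { intros t. unfold w. rewrite Cmod_mult, Cmod_Cexpi, Ht2. ring. }
  assert (w0 : w 0 = tau2) by (unfold w; rewrite Cexpi_0; ring).
  assert (Hww : forall t, Cmod (w t - w 0) <= Rabs t).
  { intros t. rewrite w0. unfold w.
    replace (tau2 * Cexpi t - tau2)%C with (tau2 * (Cexpi t - 1))%C by ring.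
    rewrite Cmod_mult, Ht2. generalize (Cmod_Cexpi_sub t). lra. }
  set (L := fun t => peval P (RtoC 0) (w t) : C).
  assert (Hnz : forall t z, Cmod z < 1 -> peval P z (w t) <> RtoC 0).
  { intros t z Hz. apply no_zeros_D_times_T; auto. }
  assert (HL : forall t, L t <> RtoC 0) by (intros t; apply Hnz; rewrite Cmod_0; lra).
  set (q := fun (t : R) (u : C) => peval (preverse P) u (w t) : C).
  destruct (lip2_peval (preverse P)) as (Kq & HKq & _ & Lq).
  assert (Hqq : forall t u, Cmod u <= 1 -> Cmod (q t u - q 0 u) <= Kq * Rabs t).
  { intros t u Hu. eapply Rle_trans; [apply Lq; auto; rewrite Hw; lra|].
    apply Rmult_le_compat_l; [assumption|]. replace (u - u)%C with (RtoC 0) by ring.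
    rewrite Cmod_0. generalize (Hww t). lra. }
  assert (Ht10 : tau1 <> RtoC 0) by (intros E; rewrite E, Cmod_0 in Ht1; lra).
  set (s := (/ tau1)%C).
  assert (Hs : Cmod s = 1) by (unfold s; rewrite Cmod_inv, Ht1 by assumption; field).
  assert (Hq0s : q 0 s = RtoC 0).
  { assert (E := peval_preverse P tau1 (w 0) Ht10). rewrite w0 in E at 1. rewrite H0 in E.
    assert (Hp : Cpow tau1 (pd1 P) <> RtoC 0) by (apply Cpow_nz; assumption).
    destruct (classic (q 0 s = RtoC 0)) as [|Hn]; [assumption|exfalso].
    apply (Cmult_neq_0 _ _ Hp Hn). symmetry. exact E. }
  destruct (slice_factor P (w 0) (HL 0)) as (l0 & Hl0 & Hq0 & _).
  destruct (root_selector (L 0) s l0 (HL 0) Hs) as (G & K & d & PG & HK & Hd & Gl & Gb & Gn).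
  destruct (FundamentalTheoremOfAlgebra.polyfun_factor G PG) as (c & rho & HG).
  set (D := length rho). set (m := pd1 P).
  (* By the resultant identity this is |L|^(2 D) (1 - X^2), where X is the product of |G(g)| over
     the roots g of the slice. Not dividing by |L|^(2 D) keeps W built from values of polynomials,
     hence expandable. *)
  set (W := fun t => (Cmod (L t) ^ 2) ^ D
                     - (Cmod c ^ 2) ^ m * prodR (fun a => Cmod (q t a) ^ 2) rho).
  assert (Ew : expandable w).
  { apply expandable_mult; [apply expandable_const|apply expandable_Cexpi]. }
  assert (EL : expandable L) by (apply expandable_peval; [apply expandable_const|assumption]).
  assert (EW : expandable (fun t => RtoC (W t))).
  { apply (expandable_ext (fun t => (Cpow (RtoC (Cmod (L t) ^ 2)) D
        + RtoC (- (Cmod c ^ 2) ^ m) * RtoC (prodR (fun a => Cmod (q t a) ^ 2)%R rho))%C)).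
    - intros t. unfold W. rewrite <- RtoC_pow, <- RtoC_mult, <- RtoC_plus. f_equal. ring.
    - apply expandable_plus; [apply expandable_Cpow, expandable_Cmod2; assumption|].
      apply expandable_mult; [apply expandable_const|].
      apply (expandable_prodR (fun a t => Cmod (q t a) ^ 2)). intros a.
      apply (expandable_Cmod2 (fun t => q t a)). apply expandable_peval; [apply expandable_const|assumption]. }
  assert (Slice : forall t, exists l, length l = m /\
    (forall u, q t u = (L t * prodC (fun g => (u - g)%C) l)%C) /\
    (forall z, peval P z (w t) = (L t * prodC (fun g => (1 - g * z)%C) l)%C) /\
    (forall a, In a l -> Cmod a <= 1) /\
    W t = (Cmod (L t) ^ 2) ^ D * (1 - (prodR (fun g => Cmod (G g)) l) ^ 2)).
  { intros t. destruct (slice_factor P (w t) (HL t)) as (l & Hl & Hq & Hp).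
    exists l. split; [assumption|]. split; [exact Hq|]. split; [exact Hp|]. split.
    - apply (slice_roots_bounded P (w t)); [apply HL|exact Hp|apply Hnz].
    - assert (E := resultant_identity G c (L t) rho l HG). fold D in E. rewrite Hl in E. fold m in E.
      rewrite (prodR_ext (fun a => Cmod (L t * prodC (fun g => (a - g)%C) l)) (fun a => Cmod (q t a))) in E.
      2:{ intros a _. unfold q. rewrite Hq. reflexivity. }
      unfold W.
      rewrite (prodR_ext (fun a => Cmod (q t a) ^ 2) (fun a => Cmod (q t a) * Cmod (q t a)))
        by (intros; ring).
      rewrite prodR_mult, <- !pow_mult, !(Nat.mul_comm 2), !pow_mult.
      replace ((Cmod c ^ m) ^ 2 * (prodR (fun a => Cmod (q t a)) rho * prodR (fun a => Cmod (q t a)) rho))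
        with ((Cmod c ^ m * prodR (fun a => Cmod (q t a)) rho) ^ 2) by ring.
      rewrite <- E. ring. }
  destruct (expandable_bounded L EL) as (KL & HKL & BL).
  set (K1 := K * Kq ^ 2).
  assert (HK1 : 0 <= K1) by (apply Rmult_le_pos; [assumption|apply pow2_ge_0]).
  assert (Gq : forall t l g, Rabs t <= 1 ->
      (forall u, q t u = (L t * prodC (fun g => (u - g)%C) l)%C) -> In g l -> Cmod g <= 1 ->
      K * Cmod (L 0 * prodC (fun a => (g - a)%C) l0) ^ 2 <= K1 * t ^ 2).
  { intros t l g Ht Hq Hg Hg1. unfold K1. rewrite Rmult_assoc. apply Rmult_le_compat_l; [assumption|].
    replace (L 0 * prodC (fun a => (g - a)%C) l0)%C with (q 0 g) by (unfold q; rewrite Hq0; reflexivity).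
    rewrite <- (pow2_abs t), <- Rpow_mult_distr. apply pow_incr. split; [apply Cmod_ge_0|].
    assert (A := Hqq t g Hg1). replace (q t g) with (RtoC 0) in A.
    - replace (0 - q 0 g)%C with (- q 0 g)%C in A by ring. rewrite Cmod_opp in A. exact A.
    - rewrite Hq, (prodC_zero (fun x => (g - x)%C) g l Hg) by ring. ring. }
  destruct (one_plus_pow_le m K1 HK1) as (K2 & HK2 & P2).
  assert (HPi : forall t l, Rabs t <= 1 -> length l = m ->
      (forall u, q t u = (L t * prodC (fun g => (u - g)%C) l)%C) ->
      (forall a, In a l -> Cmod a <= 1) ->
      prodR (fun _ => 1 + K1 * t ^ 2) l <= 1 + K2 * K1 * t ^ 2).
  { intros t l Ht Hl Hq Hb. rewrite prodR_const, Hl. assert (S := sq_le_1 t Ht).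
    rewrite Rmult_assoc. apply P2. split; nra. }
  assert (HG1 : forall t l, Rabs t <= 1 ->
      (forall u, q t u = (L t * prodC (fun g => (u - g)%C) l)%C) ->
      (forall a, In a l -> Cmod a <= 1) ->
      forall a, In a l -> 0 <= Cmod (G a) <= 1 + K1 * t ^ 2).
  { intros t l Ht Hq Hb a Ha. split; [apply Cmod_ge_0|].
    assert (A := Gq t l a Ht Hq Ha (Hb a Ha)). assert (A2 := Gb a (Hb a Ha)). lra. }
  set (K3 := K2 * K1). assert (HK3 : 0 <= K3) by (apply Rmult_le_pos; assumption).
  set (M := (KL ^ 2) ^ D * (2 * K3 + K3 * K3)).
  assert (HM : 0 <= M).
  { apply Rmult_le_pos; [apply pow_le, pow2_ge_0|nra]. }
  destruct (expandable_min W M EW HM) as (K4 & HK4 & HW).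
  (* W(0) = 0 because G equals 1 at every root of the slice t = 0. *)
  { unfold W. assert (E := resultant_identity G c (L 0) rho l0 HG).
    fold D in E. rewrite Hl0 in E. fold m in E.
    rewrite (prodR_ext (fun g => Cmod (G g)) (fun _ => 1)) in E.
    2:{ intros a Ha. rewrite (Gl a Ha). apply Cmod_1. }
    rewrite prodR_const, pow1, Rmult_1_r in E.
    rewrite (prodR_ext (fun a => Cmod (L 0 * prodC (fun g => (a - g)%C) l0)) (fun a => Cmod (q 0 a))) in E.
    2:{ intros a _. unfold q. rewrite Hq0. reflexivity. }
    rewrite (prodR_ext (fun a => Cmod (q 0 a) ^ 2) (fun a => Cmod (q 0 a) * Cmod (q 0 a)))
      by (intros; ring).
    rewrite prodR_mult, <- !pow_mult, !(Nat.mul_comm 2), !pow_mult, E. ring. }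
  { intros t Ht. destruct (Slice t) as (l & Hl & Hq & _ & Hb & ->).
    assert (A : prodR (fun g => Cmod (G g)) l <= 1 + K3 * t ^ 2).
    { eapply Rle_trans; [|apply (HPi t l); assumption]. apply prodR_le. apply (HG1 t); assumption. }
    assert (A0 : 0 <= prodR (fun g => Cmod (G g)) l)
      by (apply prodR_nonneg; intros; apply Cmod_ge_0).
    assert (S := sq_le_1 t Ht).
    set (X := prodR _ l) in *. set (Y := (Cmod (L t) ^ 2) ^ D).
    assert (HY : 0 <= Y <= (KL ^ 2) ^ D).
    { split; [apply pow_le, pow2_ge_0|]. apply pow_incr. split; [apply pow2_ge_0|].
      apply pow_incr. split; [apply Cmod_ge_0|auto]. }
    assert (HX : X ^ 2 - 1 <= (2 * K3 + K3 * K3) * t ^ 2) by nra.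
    assert (0 <= (2 * K3 + K3 * K3) * t ^ 2) by nra.
    unfold M. assert (Y * (X ^ 2 - 1) <= (KL ^ 2) ^ D * ((2 * K3 + K3 * K3) * t ^ 2)).
    { apply Rle_trans with (Y * ((2 * K3 + K3 * K3) * t ^ 2)).
      - apply Rmult_le_compat_l; lra.
      - apply Rmult_le_compat_r; lra. }
    lra. }
  set (lam := Cmod (L 0) / 2).
  assert (Hlam : 0 < lam) by (assert (A := proj1 (Cmod_gt_0 _) (HL 0)); unfold lam; lra).
  destruct (lip2_peval P) as (KP & HKP & _ & LP).
  assert (Hdm : 0 < d ^ m) by (apply pow_lt; assumption).
  (* The second bound keeps |L(t)| >= lam, half of |L(0)|; the third forces some root to lie within
     d of s. *)
  set (t0 := Rmin 1 (Rmin (lam / (KP + 1)) (lam * d ^ m / (2 * (Kq + 1))))).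
  assert (Ht0 : 0 < t0).
  { repeat apply Rmin_glb_lt; [lra| |]; apply Rdiv_lt_0_compat; try lra.
    apply Rmult_lt_0_compat; assumption. }
  assert (Hlamt : forall t, Rabs t <= t0 -> lam <= Cmod (L t)).
  { intros t Ht.
    assert (A : Cmod (L t - L 0) <= KP * Rabs t).
    { eapply Rle_trans; [apply LP; rewrite ?Hw, ?Cmod_0; lra|].
      apply Rmult_le_compat_l; [assumption|]. replace (0 - 0)%C with (RtoC 0) by ring.
      rewrite Cmod_0. generalize (Hww t). lra. }
    assert (Rabs t <= lam / (KP + 1)).
    { eapply Rle_trans; [exact Ht|]. eapply Rle_trans; [apply Rmin_r|apply Rmin_l]. }
    assert ((KP + 1) * Rabs t <= lam).
    { apply Rle_trans with ((KP + 1) * (lam / (KP + 1))); [apply Rmult_le_compat_l; lra|].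
      apply Req_le. field. lra. }
    generalize (Cmod_ge_sub (L 0) (L t)) (Rabs_pos t). rewrite Cmod_sub_sym. unfold lam in *. lra. }
  set (K5 := K4 / (lam ^ 2) ^ D).
  assert (HlD : 0 < (lam ^ 2) ^ D) by (apply pow_lt, pow_lt; assumption).
  assert (HK5 : 0 <= K5).
  { apply Rmult_le_pos; [assumption|]. apply Rlt_le, Rinv_0_lt_compat. assumption. }
  exists (K5 + K3 + K1 * (1 + K3)), t0.
  split; [nra|]. split; [split; [assumption|apply Rmin_l]|].
  intros t Ht.
  assert (Ht1' : Rabs t <= 1) by (eapply Rle_trans; [exact Ht|apply Rmin_l]).
  destruct (Slice t) as (l & Hl & Hq & Hp & Hb & HWt).
  (* If all roots were farther than d from s, then |q(t, s)| >= lam d^m, whereas q(0, s) = 0 gives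
     |q(t, s)| <= Kq |t|. *)
  assert (Hg : exists g, In g l /\ Cmod (g - s) <= d).
  { apply NNPP. intros Hn.
    assert (Hfar : d ^ m <= prodR (fun g => Cmod (s - g)) l).
    { rewrite <- Hl, <- prodR_const. apply prodR_le. intros g Hg. split; [lra|].
      destruct (Rle_lt_dec (Cmod (g - s)) d) as [A|A]; [exfalso; apply Hn; exists g; auto|].
      rewrite Cmod_sub_sym. lra. }
    assert (A := Hqq t s ltac:(lra)). rewrite Hq0s in A.
    replace (q t s - 0)%C with (q t s) in A by ring.
    rewrite Hq, Cmod_mult, Cmod_prodC in A.
    assert (A2 : lam * d ^ m <= Cmod (L t) * prodR (fun g => Cmod (s - g)) l).
    { apply Rmult_le_compat; [lra|lra|auto|assumption]. }
    assert (A3 : Rabs t <= lam * d ^ m / (2 * (Kq + 1))).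
    { eapply Rle_trans; [exact Ht|]. eapply Rle_trans; [apply Rmin_r|apply Rmin_r]. }
    assert (A4 : (Kq + 1) * Rabs t <= lam * d ^ m / 2).
    { apply Rle_trans with ((Kq + 1) * (lam * d ^ m / (2 * (Kq + 1)))); [apply Rmult_le_compat_l; lra|].
      apply Req_le. field. lra. }
    assert (0 < lam * d ^ m) by (apply Rmult_lt_0_compat; assumption).
    generalize (Rabs_pos t). lra. }
  destruct Hg as (g & Hg & Hgd).
  exists l, g. split; [assumption|]. split; [exact Hp|]. split; [assumption|]. split; [assumption|].
  set (X := prodR (fun g => Cmod (G g)) l) in *.
  assert (X0 : 0 <= X) by (apply prodR_nonneg; intros; apply Cmod_ge_0).
  assert (S := sq_le_1 t Ht1').
  assert (X1 : 1 - K5 * t ^ 2 <= X ^ 2).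
  { assert (A := HW t Ht1'). rewrite HWt in A.
    destruct (Rle_lt_dec (1 - X ^ 2) 0) as [N|N]; [nra|].
    assert (A2 : (lam ^ 2) ^ D * (1 - X ^ 2) <= K4 * t ^ 2).
    { eapply Rle_trans; [|exact A]. apply Rmult_le_compat_r; [lra|].
      apply pow_incr. split; [apply pow2_ge_0|]. apply pow_incr. split; [lra|auto]. }
    assert (A3 : 1 - X ^ 2 <= K5 * t ^ 2).
    { apply Rmult_le_reg_l with ((lam ^ 2) ^ D); [assumption|].
      replace ((lam ^ 2) ^ D * (K5 * t ^ 2)) with (K4 * t ^ 2) by (unfold K5; field; lra).
      assumption. }
    lra. }
  assert (X2 : 1 - K5 * t ^ 2 <= X).
  { assert (0 <= K5 * t ^ 2) by nra.
    destruct (Rle_lt_dec (1 - K5 * t ^ 2) X) as [|N]; [assumption|]. nra. }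
  (* The factor at the chosen root is bounded by |g| + O(t^2), all others by 1 + O(t^2). With X >= 1
     - O(t^2) this pushes |g| up to 1 - O(t^2). *)
  assert (X3 : X <= (Cmod g + K1 * t ^ 2) * (1 + K3 * t ^ 2)).
  { eapply Rle_trans.
    - apply (prodR_le_one_factor (fun g => Cmod (G g)) (fun _ => 1 + K1 * t ^ 2) g l Hg).
      + apply (HG1 t); assumption.
      + intros. nra.
    - apply Rmult_le_compat; [apply Cmod_ge_0| | |apply (HPi t l); assumption].
      + apply prodR_nonneg. intros. nra.
      + assert (A := Gq t l g Ht1' Hq Hg (Hb g Hg)). assert (A2 := Gn g (Hb g Hg) Hgd). lra. }
  assert (Hg1 := Hb g Hg). assert (Hg0 := Cmod_ge_0 g).
  assert (0 <= K3 * t ^ 2) by nra. assert (0 <= K1 * t ^ 2) by nra.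
  assert (Cmod g * (K3 * t ^ 2) <= K3 * t ^ 2) by nra.
  assert (K1 * t ^ 2 * (K3 * t ^ 2) <= K1 * K3 * t ^ 2).
  { replace (K1 * t ^ 2 * (K3 * t ^ 2)) with (K1 * K3 * t ^ 2 * t ^ 2) by ring.
    assert (0 <= K1 * K3 * t ^ 2) by (apply Rmult_le_pos; [apply Rmult_le_pos|]; lra). nra. }
  lra.
Qed.

(** * Difference quotients of the rational inner function *)

(** The divided difference (w^i - z^i) / (w - z) as a polynomial, so that w = z is allowed and gives
    i z^(i-1). *)
Fixpoint ddpow (i : nat) (w z : C) : C :=
  match i with O => RtoC 0 | S k => (Cpow w k + z * ddpow k w z)%C end.

Lemma ddpow_spec i w z : Cpow w i = (Cpow z i + (w - z) * ddpow i w z)%C.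
Proof. induction i as [|i IH]; simpl; [ring|]. rewrite IH at 1. rewrite IH. ring. Qed.

Definition pdd (P : poly2) (w z v : C) : C :=
  Csum (S (pd1 P)) (fun i => Csum (S (pd2 P)) (fun j =>
    Cmult (coef P i j) (Cmult (ddpow i w z) (Cpow v j)))).

Lemma pdd_spec P w z v : peval P w v = (peval P z v + (w - z) * pdd P w z v)%C.
Proof.
  rewrite !peval_Csum. unfold pdd. rewrite <- Csum_scal, <- Csum_plus.
  apply Csum_ext. intros i _. rewrite <- Csum_scal, <- Csum_plus.
  apply Csum_ext. intros j _. rewrite (ddpow_spec i w z). Ceq; ring.
Qed.

Lemma lip2_ddpow i F G : lip2 F -> lip2 G -> lip2 (fun z w => ddpow i (F z w) (G z w)).
Proof.
  intros HF HG. induction i as [|i IH]; simpl; [apply lip2_const|].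
  apply (lip2_plus (fun z w => Cpow (F z w) i)); [apply lip2_Cpow; assumption|].
  apply (lip2_mult G); assumption.
Qed.

Lemma lip2_pdd P F G V : lip2 F -> lip2 G -> lip2 V ->
  lip2 (fun z w => pdd P (F z w) (G z w) (V z w)).
Proof.
  intros HF HG HV. unfold pdd. apply lip2_Csum; intros i. apply lip2_Csum; intros j.
  apply lip2_mult; [apply lip2_const|].
  apply lip2_mult; [apply lip2_ddpow; assumption|apply lip2_Cpow; assumption].
Qed.

Lemma lip2_peval_comp P F V : lip2 F -> lip2 V -> lip2 (fun z w => peval P (F z w) (V z w)).
Proof.
  intros HF HV. apply (lip2_ext _ _ (fun z w => eq_sym (peval_Csum P (F z w) (V z w)))).
  apply lip2_Csum; intros i. apply lip2_Csum; intros j.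
  apply lip2_mult; [apply lip2_const|].
  apply lip2_mult; apply lip2_Cpow; assumption.
Qed.

(** Numerator of (phi(w, v) - phi(z, v)) / (w - z) after cancellation of w - z. Thus [slope P z z v]
    is the partial derivative in the first variable, and stays meaningful at boundary points where p
    does not vanish. *)
Definition slope_num (P : poly2) (w z v : C) : C :=
  (pdd (ptilde P) w z v * peval P z v - peval (ptilde P) z v * pdd P w z v)%C.
Definition slope_den (P : poly2) (w z v : C) : C := (peval P w v * peval P z v)%C.
Definition slope (P : poly2) (w z v : C) : C := (slope_num P w z v / slope_den P w z v)%C.

Lemma lip2_slope_num P F G V : lip2 F -> lip2 G -> lip2 V ->
  lip2 (fun z w => slope_num P (F z w) (G z w) (V z w)).
Proof.
  intros HF HG HV.
  apply (lip2_ext (fun z w => (pdd (ptilde P) (F z w) (G z w) (V z w) * peval P (G z w) (V z w)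
     + RtoC (-1) * (peval (ptilde P) (G z w) (V z w) * pdd P (F z w) (G z w) (V z w)))%C)).
  - intros z w. unfold slope_num. Ceq. ring.
  - apply lip2_plus.
    + apply lip2_mult; [apply lip2_pdd|apply lip2_peval_comp]; assumption.
    + apply lip2_mult; [apply lip2_const|].
      apply lip2_mult; [apply lip2_peval_comp|apply lip2_pdd]; assumption.
Qed.

Lemma lip2_slope_den P F G V : lip2 F -> lip2 G -> lip2 V ->
  lip2 (fun z w => slope_den P (F z w) (G z w) (V z w)).
Proof. intros. apply lip2_mult; apply lip2_peval_comp; assumption. Qed.

Lemma lip2_common F G : lip2 F -> lip2 G -> exists K, 0 <= K /\
  forall z w z' w', Cmod z <= 1 -> Cmod w <= 1 -> Cmod z' <= 1 -> Cmod w' <= 1 ->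
    Cmod (F z w) <= K /\
    Cmod (F z w - F z' w') <= K * (Cmod (z - z') + Cmod (w - w')) /\
    Cmod (G z w - G z' w') <= K * (Cmod (z - z') + Cmod (w - w')).
Proof.
  intros (K & HK & Hb & Hl) (K' & HK' & Hb' & Hl').
  exists (K + K'). split; [lra|]. intros z w z' w' H1 H2 H3 H4.
  assert (A1 := Hb z w H1 H2). assert (A2 := Hl _ _ _ _ H1 H2 H3 H4).
  assert (A3 := Hl' _ _ _ _ H1 H2 H3 H4).
  assert (0 <= Cmod (z - z') + Cmod (w - w')) by (apply Rplus_le_le_0_compat; apply Cmod_ge_0).
  repeat split; nra.
Qed.

Lemma RIF_div P z w : RIF P z w = (peval (ptilde P) z w / peval P z w)%C.
Proof. apply Defs_Cdiv. Qed.

Lemma RIF_slope P w z v : peval P w v <> RtoC 0 -> peval P z v <> RtoC 0 ->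
  (RIF P w v - RIF P z v = (w - z) * slope P w z v)%C.
Proof.
  intros Hw Hz. rewrite !RIF_div. unfold slope, slope_num, slope_den.
  assert (E1 := pdd_spec P w z v). assert (E2 := pdd_spec (ptilde P) w z v).
  rewrite E2.
  replace (pdd P w z v * peval (ptilde P) z v)%C with (peval (ptilde P) z v * pdd P w z v)%C by (Ceq; ring).
  set (a := peval P w v : C) in *. set (b := peval P z v : C) in *.
  set (c := peval (ptilde P) z v : C) in *. set (d := pdd P w z v) in *.
  set (e := pdd (ptilde P) w z v) in *. change (a <> RtoC 0) in Hw. change (b <> RtoC 0) in Hz.
  clearbody a b c d e. subst a. field. split; assumption.
Qed.

(** Serves twice: at interior points to identify the derivative, and at points of the circle to
    compare it with radial difference quotients. *)
Lemma slope_lipschitz_at P z v : Cmod z <= 1 -> peval P z v <> RtoC 0 ->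
  exists K rho, 0 <= K /\ 0 < rho /\ forall w, Cmod w <= 1 -> Cmod (w - z) <= rho ->
    peval P w v <> RtoC 0 /\ Cmod (slope P w z v - slope P z z v) <= K * Cmod (w - z).
Proof.
  intros Hz Hp.
  destruct (lip2_common (fun w z => slope_num P w z v) (fun w z => slope_den P w z v))
    as (K & HK & H).
  { apply (lip2_slope_num P (fun z _ => z) (fun _ w => w) (fun _ _ => v));
      auto using lip2_fst, lip2_snd, lip2_const. }
  { apply (lip2_slope_den P (fun z _ => z) (fun _ w => w) (fun _ _ => v));
      auto using lip2_fst, lip2_snd, lip2_const. }
  set (c := Cmod (slope_den P z z v)).
  assert (Hc : 0 < c) by (apply Cmod_gt_0, Cmult_neq_0; assumption).
  exists (2 * K / c + 2 * K * K / (c * c)), (c / (2 * (K + 1))).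
  split; [|split].
  - assert (0 <= 2 * K / c) by (apply Rmult_le_pos; [lra|apply Rlt_le, Rinv_0_lt_compat; lra]).
    assert (0 <= 2 * K * K / (c * c)).
    { apply Rmult_le_pos; [nra|]. apply Rlt_le, Rinv_0_lt_compat. nra. }
    lra.
  - apply Rdiv_lt_0_compat; lra.
  - intros w Hw Hd. destruct (H w z z z Hw Hz Hz Hz) as (_ & H2 & H3).
    destruct (H z z z z Hz Hz Hz Hz) as (H1 & _).
    replace (z - z)%C with (RtoC 0) in H2, H3 by ring. rewrite Cmod_0, Rplus_0_r in H2, H3.
    destruct (quotient_lipschitz _ _ _ _ K c (Cmod (w - z)) HK Hc (Cmod_ge_0 _) H2 H3 H1
                (Rle_refl _)) as (Hn & Hq).
    + assert (0 <= Cmod (w - z)) by apply Cmod_ge_0.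
      apply Rle_trans with ((K + 1) * (c / (2 * (K + 1)))).
      * apply Rmult_le_compat; lra.
      * apply Req_le. field. lra.
    + split; [|exact Hq]. intros E. apply Hn. unfold slope_den. rewrite E. Ceq; ring.
Qed.

Lemma partial1_slope P z v d :
  no_zeros_in_D2 P -> inD2 z v -> is_partial1_at (RIF P) z v d -> d = slope P z z v.
Proof.
  intros Hno Hin Hd. assert (Hp : peval P z v <> RtoC 0) by (apply Hno; assumption).
  assert (Hz : Cmod z < 1) by (rewrite <- Cnorm_Cmod; apply Hin).
  destruct (slope_lipschitz_at P z v (Rlt_le _ _ Hz) Hp) as (K & rho & HK & Hrho & HS).
  cut (Cmod (d - slope P z z v) <= 0).
  { intros H. assert (E : (d - slope P z z v)%C = RtoC 0).
    { apply Cmod_eq_0. generalize (Cmod_ge_0 (d - slope P z z v)). lra. }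
    replace d with (d - slope P z z v + slope P z z v)%C by (Ceq; ring).
    rewrite E. Ceq; ring. }
  apply Rle_of_forall_eps with (K := 1 + K). intros e He.
  destruct (Hd e) as (del & Hdel & Hd'); [lra|].
  (* A real increment suffices to identify d. The last bound keeps z + eta in the closed disc. *)
  set (eta := Rmin (Rmin e (del / 2)) (Rmin rho (1 - Cmod z))).
  assert (Heta : 0 < eta) by (repeat apply Rmin_glb_lt; lra).
  assert (E1 : eta <= e) by (eapply Rle_trans; [apply Rmin_l|apply Rmin_l]).
  assert (E2 : eta <= del / 2) by (eapply Rle_trans; [apply Rmin_l|apply Rmin_r]).
  assert (E3 : eta <= rho) by (eapply Rle_trans; [apply Rmin_r|apply Rmin_l]).
  assert (E4 : eta <= 1 - Cmod z) by (eapply Rle_trans; [apply Rmin_r|apply Rmin_r]).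
  assert (Hh : Cmod (RtoC eta) = eta) by (rewrite Cmod_R; apply Rabs_pos_eq; lra).
  assert (Hh0 : RtoC eta <> RtoC 0) by (intros E; apply RtoC_inj in E; lra).
  assert (Hw1 : Cmod (z + eta) <= 1).
  { eapply Rle_trans; [apply Cmod_triangle|]. lra. }
  assert (Hwz : Cmod (z + eta - z) = eta).
  { replace (z + eta - z)%C with (RtoC eta) by ring. assumption. }
  destruct (HS (z + eta)%C Hw1) as (Hpw & HSw); [lra|].
  assert (A := Hd' (RtoC eta) Hh0). rewrite !Cnorm_Cmod in A.
  specialize (A ltac:(lra)). rewrite Defs_Cdiv in A.
  change (Cmod ((RIF P (z + eta)%C v - RIF P z v) / eta - d) < e) in A.
  rewrite (RIF_slope P (z + eta)%C z v Hpw Hp) in A.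
  replace ((z + eta - z) * slope P (z + eta) z v / eta)%C with (slope P (z + eta) z v) in A
    by (Ceq; field; assumption).
  rewrite Hwz in HSw.
  replace (d - slope P z z v)%C
    with ((slope P (z + eta) z v - slope P z z v) - (slope P (z + eta) z v - d))%C by (Ceq; ring).
  eapply Rle_trans; [apply Cmod_minus_le|]. nra.
Qed.

(** * Lower bound for the derivative on the torus *)

(** For nonzero k it reads: a product of ratios h/k, all at most 1, is at most the ratio at g. A
    Blaschke product is thus dominated by each of its factors. The form without division tolerates
    vanishing factors. *)
Lemma prodR_ratio h k g l : In g l -> (forall a, In a l -> 0 <= h a <= k a) ->
  k g * prodR h l <= h g * prodR k l.
Proof.
  induction l as [|a l IH]; simpl; intros Hg H; [tauto|].
  assert (Hl : prodR h l <= prodR k l) by (apply prodR_le; auto).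
  assert (Hh : 0 <= prodR h l) by (apply prodR_nonneg; intros x Hx; apply (H x); auto).
  assert (Ha := H a (or_introl eq_refl)).
  destruct Hg as [->|Hg].
  - assert (k g * h g * prodR h l <= k g * h g * prodR k l)
      by (apply Rmult_le_compat_l; [nra|assumption]). lra.
  - assert (A := IH Hg (fun x hx => H x (or_intror hx))).
    assert (B := H g (or_intror Hg)).
    apply Rle_trans with (h a * (h g * prodR k l)).
    + assert (h a * (k g * prodR h l) <= h a * (h g * prodR k l)) by (apply Rmult_le_compat_l; lra).
      lra.
    + assert (0 <= h g * prodR k l) by nra. nra.
Qed.

(** Together with the factorization of p(., v), it exhibits |phi(., v)| as the modulus of a Blaschke
    product with zeros conj(a). *)
Lemma Cmod_ptilde_slice P v Lv l z : Cmod v = 1 -> z <> RtoC 0 -> length l = pd1 P ->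
  (forall x, peval P x v = (Lv * prodC (fun a => (1 - a * x)%C) l)%C) ->
  Cmod (peval (ptilde P) z v) = Cmod Lv * prodR (fun a => Cmod (z - Cconj a)) l.
Proof.
  intros Hv Hz Hl H.
  assert (Hv0 : v <> RtoC 0) by (intros E; rewrite E, Cmod_0 in Hv; lra).
  rewrite peval_ptilde by assumption.
  assert (Hvc : (/ Cconj v)%C = v).
  { assert (E := Cmod2_conj v). rewrite Hv in E.
    assert (E1 : (v * Cconj v)%C = RtoC 1) by (rewrite <- E; f_equal; ring).
    assert (Hc : Cconj v <> RtoC 0).
    { intros F. rewrite F in E1. replace (v * 0)%C with (RtoC 0) in E1 by ring.
      apply RtoC_inj in E1. lra. }
    replace v with (v * Cconj v / Cconj v)%C at 2 by (field; assumption).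
    rewrite E1. field. assumption. }
  assert (Hzc : Cconj z <> RtoC 0).
  { intros E. apply Hz. rewrite <- (Cconj_conj z), E. unfold Cconj, RtoC; simpl. f_equal. ring. }
  rewrite Hvc, !Cmod_mult, !Cmod_pow, Hv, pow1, Cmod_conj, H, Cmod_mult, Cmod_prodC.
  rewrite <- Hl, <- (prodR_const (Cmod z)).
  replace (prodR (fun a => Cmod (z - Cconj a)) l)
    with (prodR (fun _ => Cmod z) l * prodR (fun a => Cmod (1 - a * / Cconj z)) l); [ring|].
  rewrite <- prodR_mult. apply prodR_ext. intros a _.
  rewrite <- (Cmod_conj z), <- Cmod_mult, <- (Cmod_conj (z - Cconj a)), Cminus_conj, Cconj_conj.
  f_equal. field. assumption.
Qed.

Lemma blaschke_identity (a z : C) :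
  Cmod (1 - a * z) ^ 2 - Cmod (z - Cconj a) ^ 2 = (1 - Cmod a ^ 2) * (1 - Cmod z ^ 2).
Proof. rewrite !Cmod_sqr. simpl. ring. Qed.

Lemma blaschke_le (a z : C) : Cmod a <= 1 -> Cmod z <= 1 ->
  Cmod (z - Cconj a) <= Cmod (1 - a * z).
Proof.
  intros Ha Hz. 
  apply Rsqr_incr_0; try apply Cmod_ge_0. rewrite !Rsqr_pow2.
  assert (E := blaschke_identity a z).
  assert (0 <= 1 - Cmod a ^ 2) by (generalize (Cmod_ge_0 a); nra).
  assert (0 <= 1 - Cmod z ^ 2) by (generalize (Cmod_ge_0 z); nra). nra.
Qed.

(** Since |phi(zeta, v)| = 1, the derivative is at least the radial limit of (1 - |phi(w, v)|) / (1
    - |w|), and |phi(w, v)| is at most the single Blaschke factor N / D attached to g. *)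
Lemma slope_boundary_lower P v Lv l g zeta :
  Cmod v = 1 -> length l = pd1 P ->
  (forall x, peval P x v = (Lv * prodC (fun a => (1 - a * x)%C) l)%C) ->
  (forall a, In a l -> Cmod a <= 1) -> In g l -> Cmod g < 1 ->
  Cmod zeta = 1 -> peval P zeta v <> RtoC 0 ->
  Cmod (1 - g * zeta) <= 2 * (1 - Cmod g) ->
  / (18 * (1 - Cmod g)) <= Cmod (slope P zeta zeta v).
Proof.
  intros Hv Hl H Hb Hg Hg1 Hzeta Hp Hnear.
  set (y := 1 - Cmod g) in *. assert (Hy : 0 < y <= 1) by (generalize (Cmod_ge_0 g); unfold y; lra).
  assert (HL : Lv <> RtoC 0).
  { intros E. apply Hp. rewrite H, E. Ceq; ring. }
  assert (HLm := proj1 (Cmod_gt_0 _) HL).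
  assert (Hmod : forall x, x <> RtoC 0 -> peval P x v <> RtoC 0 ->
     Cmod (RIF P x v) * prodR (fun a => Cmod (1 - a * x)) l = prodR (fun a => Cmod (x - Cconj a)) l
     /\ 0 < prodR (fun a => Cmod (1 - a * x)) l).
  { intros x Hx Hpx.
    assert (Hpos : 0 < prodR (fun a => Cmod (1 - a * x)) l).
    { assert (A := proj1 (Cmod_gt_0 _) Hpx). rewrite H, Cmod_mult, Cmod_prodC in A.
      assert (B : 0 <= prodR (fun a => Cmod (1 - a * x)) l)
        by (apply prodR_nonneg; intros; apply Cmod_ge_0). nra. }
    split; [|assumption].
    rewrite RIF_div, Cmod_div by assumption.
    rewrite (Cmod_ptilde_slice P v Lv l x) by assumption.
    rewrite H, Cmod_mult, Cmod_prodC. field. lra. }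
  assert (Hz0 : zeta <> RtoC 0) by (intros E; rewrite E, Cmod_0 in Hzeta; lra).
  assert (H1 : Cmod (RIF P zeta v) = 1).
  { destruct (Hmod zeta Hz0 Hp) as (E & Hpos).
    rewrite (prodR_ext (fun a => Cmod (zeta - Cconj a)) (fun a => Cmod (1 - a * zeta))) in E.
    - apply Rmult_eq_reg_r with (prodR (fun a => Cmod (1 - a * zeta)) l); lra.
    - intros a _. assert (E' := blaschke_identity a zeta). rewrite Hzeta in E'.
      apply Rsqr_inj; try apply Cmod_ge_0. rewrite !Rsqr_pow2. lra. }
  destruct (slope_lipschitz_at P zeta v (Req_le _ _ Hzeta) Hp) as (K & rho & HK & Hrho & HS).
  cut (/ (18 * y) - Cmod (slope P zeta zeta v) <= 0); [lra|].
  apply Rle_of_forall_eps with (K := K). intros e He.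
  (* eta <= 1/2 keeps w away from 0, and eta <= y gives D <= 2 y + eta <= 3 y. *)
  set (eta := Rmin (Rmin e (1 / 2)) (Rmin rho y)).
  assert (Heta : 0 < eta) by (repeat apply Rmin_glb_lt; lra).
  assert (E1 : eta <= e) by (eapply Rle_trans; [apply Rmin_l|apply Rmin_l]).
  assert (E2 : eta <= 1 / 2) by (eapply Rle_trans; [apply Rmin_l|apply Rmin_r]).
  assert (E3 : eta <= rho) by (eapply Rle_trans; [apply Rmin_r|apply Rmin_l]).
  assert (E4 : eta <= y) by (eapply Rle_trans; [apply Rmin_r|apply Rmin_r]).
  set (w := (RtoC (1 - eta) * zeta)%C).
  assert (Hw : Cmod w = 1 - eta) by (unfold w; rewrite Cmod_dilate, Hzeta by lra; ring).
  assert (Hwz : Cmod (w - zeta) = eta).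
  { replace (w - zeta)%C with (RtoC (- eta) * zeta)%C.
    - rewrite Cmod_mult, Cmod_R, Rabs_Ropp, Hzeta, Rabs_pos_eq; lra.
    - unfold w. rewrite RtoC_minus, RtoC_opp. ring. }
  destruct (HS w) as (Hpw & HSw); [lra|lra|]. rewrite Hwz in HSw.
  assert (Hw0 : w <> RtoC 0) by (intros E; rewrite E, Cmod_0 in Hw; lra).
  destruct (Hmod w Hw0 Hpw) as (Ew & Hposw).
  set (D := Cmod (1 - g * w)). set (N := Cmod (w - Cconj g)).
  assert (HDN := blaschke_identity g w). fold D N in HDN. rewrite Hw in HDN.
  assert (HN : 0 <= N) by apply Cmod_ge_0.
  assert (HD : 0 <= D) by apply Cmod_ge_0.
  assert (HD3 : D <= 3 * y).
  { unfold D. replace (1 - g * w)%C with ((1 - g * zeta) - g * (w - zeta))%C by ring.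
    eapply Rle_trans; [apply Cmod_minus_le|]. rewrite Cmod_mult, Hwz.
    assert (Cmod g * eta <= eta) by nra. lra. }
  assert (Hlow : y * eta <= D ^ 2 - N ^ 2).
  { rewrite HDN. replace (1 - Cmod g ^ 2) with (y * (1 + Cmod g)) by (unfold y; ring).
    replace (1 - (1 - eta) ^ 2) with (eta * (2 - eta)) by ring.
    assert (0 <= Cmod g) by apply Cmod_ge_0. assert (0 < y * eta) by nra.
    replace (y * (1 + Cmod g) * (eta * (2 - eta))) with ((y * eta) * ((1 + Cmod g) * (2 - eta))) by ring.
    assert (1 <= (1 + Cmod g) * (2 - eta)) by nra. nra. }
  assert (HD0 : 0 < D) by nra.
  assert (Hphi : Cmod (RIF P w v) * D <= N).
  { assert (A := prodR_ratio (fun a => Cmod (w - Cconj a)) (fun a => Cmod (1 - a * w)) g l Hg).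
    cbv beta in A. fold D N in A.
    assert (A' : D * prodR (fun a => Cmod (w - Cconj a)) l <= N * prodR (fun a => Cmod (1 - a * w)) l).
    { apply A. intros a Ha. split; [apply Cmod_ge_0|]. apply blaschke_le; [auto|lra]. }
    rewrite <- Ew in A'. apply Rmult_le_reg_r with (prodR (fun a => Cmod (1 - a * w)) l); lra. }
  (* 1 - N / D >= (D^2 - N^2) / (2 D^2) >= y eta / (2 (3 y)^2), whence 18. *)
  assert (Hgap : eta * / (18 * y) <= 1 - Cmod (RIF P w v)).
  { assert (HND : N <= D) by nra.
    assert (A1 : y * eta <= (D - N) * (2 * D)) by nra.
    assert (A2 : (D - N) <= (1 - Cmod (RIF P w v)) * D) by lra.
    assert (A3 : y * eta <= (1 - Cmod (RIF P w v)) * (2 * D ^ 2)) by nra.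
    assert (A4 : 0 <= 1 - Cmod (RIF P w v)) by nra.
    assert (A5 : D ^ 2 <= 9 * y ^ 2) by nra.
    apply Rmult_le_reg_r with (18 * y ^ 2); [nra|].
    replace (eta * / (18 * y) * (18 * y ^ 2)) with (y * eta) by (field; lra).
    nra. }
  assert (Hdiff : 1 - Cmod (RIF P w v) <= eta * Cmod (slope P w zeta v)).
  { rewrite <- Hwz, <- Cmod_mult, <- (RIF_slope P w zeta v Hpw Hp), <- H1, Cmod_sub_sym.
    apply Cmod_ge_sub. }
  assert (Hs : / (18 * y) <= Cmod (slope P w zeta v)) by (apply Rmult_le_reg_l with eta; lra).
  assert (A := Cmod_ge_sub (slope P w zeta v) (slope P zeta zeta v)). nra.
Qed.

Lemma Cmod_Cexpi_diff s t : Cmod (Cexpi s - Cexpi t) <= Rabs (s - t).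
Proof.
  replace s with (t + (s - t)) at 1 by ring. rewrite Cexpi_plus.
  replace (Cexpi t * Cexpi (s - t) - Cexpi t)%C with (Cexpi t * (Cexpi (s - t) - 1))%C by (Ceq; ring).
  rewrite Cmod_mult, Cmod_Cexpi, Rmult_1_l. apply Cmod_Cexpi_sub.
Qed.

(** The gauge is a fixed fraction of |p|, so the uniform size d given by compactness is itself a
    lower bound for |p|. *)
Lemma peval_away_from_zero P a b a' b' :
  (forall s t, a <= s <= b -> a' <= t <= b' -> peval P (Cexpi s) (Cexpi t) <> RtoC 0) ->
  exists c, 0 < c /\
    forall s t, a <= s <= b -> a' <= t <= b' -> c <= Cmod (peval P (Cexpi s) (Cexpi t)).
Proof.
  intros Hnz. destruct (lip2_peval P) as (K & HK & _ & HL).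
  set (F := fun s t => Cmod (peval P (Cexpi s) (Cexpi t)) / (4 * (K + 1))).
  (* The default 1 only makes the gauge positive everywhere; on the rectangle F > 0. *)
  set (delta := fun s t => match Rlt_dec 0 (F s t) with
                 | left H => mkposreal _ H | right _ => mkposreal 1 Rlt_0_1 end).
  destruct (compactness_value_2d a b a' b' delta) as (d & Hd).
  exists d. split; [apply cond_pos|]. intros s t Hs Ht.
  apply NNPP. intros Hn. apply (Hd s t Hs Ht). intros (u & v & Hu & Hv & H1 & H2 & H3).
  apply Hn. assert (Hp := proj1 (Cmod_gt_0 _) (Hnz u v Hu Hv)).
  assert (HF : 0 < F u v) by (apply Rdiv_lt_0_compat; lra).
  unfold delta in H1, H2, H3. destruct (Rlt_dec 0 (F u v)) as [HF'|]; [|tauto]. simpl in H1, H2, H3.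
  assert (A := HL (Cexpi s) (Cexpi t) (Cexpi u) (Cexpi v)). rewrite !Cmod_Cexpi in A.
  specialize (A ltac:(lra) ltac:(lra) ltac:(lra) ltac:(lra)).
  generalize (Cmod_Cexpi_diff s u) (Cmod_Cexpi_diff t v); intros A1 A2.
  assert (EF : Cmod (peval P (Cexpi u) (Cexpi v)) = 4 * (K + 1) * F u v) by (unfold F; field; lra).
  assert (A3 := Cmod_ge_sub (peval P (Cexpi u) (Cexpi v)) (peval P (Cexpi s) (Cexpi t))).
  rewrite Cmod_sub_sym in A3.
  assert (A4 : K * (Cmod (Cexpi s - Cexpi u) + Cmod (Cexpi t - Cexpi v)) <= K * (2 * F u v))
    by (apply Rmult_le_compat_l; lra).
  assert (A5 : 0 <= K * F u v) by nra.
  lra.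
Qed.

(** Carries lower bounds on the torus to the torus of radius r, with a loss that is uniform over a
    rectangle of angles free of zeros. *)
Lemma slope_dilate P a b a' b' :
  (forall s t, a <= s <= b -> a' <= t <= b' -> peval P (Cexpi s) (Cexpi t) <> RtoC 0) ->
  exists K r0, 0 <= K /\ 0 < r0 < 1 /\ forall r s t, r0 <= r < 1 -> a <= s <= b -> a' <= t <= b' ->
    Cmod (slope P (Cexpi s) (Cexpi s) (Cexpi t)) - K * (1 - r)
    <= Cmod (slope P (r * Cexpi s) (r * Cexpi s) (r * Cexpi t)).
Proof.
  intros Hnz. destruct (peval_away_from_zero P a b a' b' Hnz) as (c0 & Hc0 & Hc).
  destruct (lip2_common (fun z v => slope_num P z z v) (fun z v => slope_den P z z v))
    as (K & HK & H).
  { apply (lip2_slope_num P (fun z _ => z) (fun z _ => z) (fun _ w => w));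
      auto using lip2_fst, lip2_snd. }
  { apply (lip2_slope_den P (fun z _ => z) (fun z _ => z) (fun _ w => w));
      auto using lip2_fst, lip2_snd. }
  set (c := c0 * c0). assert (Hcp : 0 < c) by (apply Rmult_lt_0_compat; assumption).
  set (e := Rmin (1 / 2) (c / (4 * (K + 1)))).
  assert (He : 0 < e) by (apply Rmin_glb_lt; [lra|apply Rdiv_lt_0_compat; lra]).
  assert (He1 : e <= 1 / 2) by apply Rmin_l.
  assert (He2 : e <= c / (4 * (K + 1))) by apply Rmin_r.
  set (K' := 2 * K / c + 2 * K * K / (c * c)).
  assert (HK' : 0 <= K').
  { assert (0 <= 2 * K / c) by (apply Rmult_le_pos; [lra|apply Rlt_le, Rinv_0_lt_compat; lra]).
    assert (0 <= 2 * K * K / (c * c)).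
    { apply Rmult_le_pos; [nra|]. apply Rlt_le, Rinv_0_lt_compat. nra. }
    unfold K'; lra. }
  exists (K' * 2), (1 - e). split; [lra|]. split; [lra|].
  intros r s t Hr Hs Ht. set (z := Cexpi s : C). set (v := Cexpi t : C).
  assert (Hz : Cmod z = 1) by apply Cmod_Cexpi. assert (Hv : Cmod v = 1) by apply Cmod_Cexpi.
  assert (Hrz : Cmod (r * z) <= 1) by (rewrite Cmod_dilate by lra; rewrite Hz; lra).
  assert (Hrv : Cmod (r * v) <= 1) by (rewrite Cmod_dilate by lra; rewrite Hv; lra).
  assert (D1 := Cmod_dilate_sub r z ltac:(lra) ltac:(lra)).
  assert (D2 := Cmod_dilate_sub r v ltac:(lra) ltac:(lra)).
  destruct (H (r * z)%C (r * v)%C z v Hrz Hrv ltac:(lra) ltac:(lra)) as (_ & H2 & H3).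
  destruct (H z v z v ltac:(lra) ltac:(lra) ltac:(lra) ltac:(lra)) as (H1 & _).
  assert (D3 : K * (Cmod (r * z - z) + Cmod (r * v - v)) <= K * (2 * (1 - r)))
    by (apply Rmult_le_compat_l; lra).
  destruct (quotient_lipschitz (slope_num P (r * z) (r * z) (r * v)) (slope_num P z z v)
     (slope_den P (r * z) (r * z) (r * v)) (slope_den P z z v) K c (2 * (1 - r))) as (_ & Hq).
  - assumption.
  - assumption.
  - lra.
  - lra.
  - lra.
  - assumption.
  - unfold slope_den. rewrite Cmod_mult. unfold c. apply Rmult_le_compat; try lra; apply Hc; assumption.
  - apply Rle_trans with ((K + 1) * (2 * (c / (4 * (K + 1))))).
    + apply Rmult_le_compat; lra.
    + apply Req_le. field. lra.
  - fold K' in Hq. fold (slope P z z v) in Hq.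
    fold (slope P (r * z) (r * z) (r * v)) in Hq. rewrite Cmod_sub_sym in Hq.
    assert (A := Cmod_ge_sub (slope P z z v) (slope P (r * z) (r * z) (r * v))). lra.
Qed.

(** * Iterated integrals of continuous functions *)

Lemma continuity_2d_pt_swap (h : R -> R -> R) x y :
  continuity_2d_pt h x y -> continuity_2d_pt (fun u v => h v u) y x.
Proof. intros H eps. destruct (H eps) as (d & Hd). exists d. intros; apply Hd; assumption. Qed.

Lemma continuous_section (h : R -> R -> R) t s :
  continuity_2d_pt h s t -> continuous (fun x => h x t) s.
Proof.
  intros H. apply continuity_pt_filterlim. intros e He.
  destruct (H (mkposreal e He)) as (d & Hd). exists d. split; [apply cond_pos|].
  intros x (_ & Hx). apply Hd; [exact Hx|]. rewrite Rminus_diag, Rabs_R0. apply cond_pos.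
Qed.

Lemma ex_RInt_section (h : R -> R -> R) a b t :
  (forall x y, continuity_2d_pt h x y) -> ex_RInt (fun s => h s t) a b.
Proof. intros H. apply (ex_RInt_continuous (V := R_CompleteNormedModule)). intros s _.
  apply (continuous_section h). apply H.
Qed.

Lemma continuous_RInt_section (h : R -> R -> R) a b t0 :
  (forall x y, continuity_2d_pt h x y) ->
  continuous (fun t => RInt (fun s => h s t) a b) t0.
Proof.
  intros Hc.
  assert (Hle : forall a b, a <= b -> continuous (fun t => RInt (fun s => h s t) a b) t0).
  { clear a b. intros a b Hab. apply continuity_pt_filterlim. intros e He.
    assert (He' : 0 < e / (2 * (b - a + 1))) by (apply Rdiv_lt_0_compat; lra).
    destruct (uniform_continuity_2d_1d h a b t0 (fun x _ => Hc x t0) (mkposreal _ He')) as (d & Hd).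
    exists d. split; [apply cond_pos|]. intros t (_ & Ht).
    change (Rabs (t - t0) < d) in Ht.
    change (Rabs (RInt (fun s => h s t) a b - RInt (fun s => h s t0) a b) < e).
    assert (E : RInt (fun s => h s t) a b - RInt (fun s => h s t0) a b
                = RInt (fun s => h s t - h s t0) a b).
    { symmetry. apply (RInt_minus (V := R_CompleteNormedModule)); apply ex_RInt_section; assumption. }
    rewrite E. apply Rle_lt_trans with ((b - a) * (e / (2 * (b - a + 1)))).
    - apply abs_RInt_le_const; [assumption| |].
      + apply (ex_RInt_minus (V := R_NormedModule)); apply ex_RInt_section; assumption.
      + intros s Hs. apply Rlt_le. apply Rabs_lt_between in Ht.
        assert (0 < d) by apply cond_pos.
        apply (Hd s t0 s t); try lra. rewrite Rminus_diag, Rabs_R0. apply cond_pos.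
    - apply Rle_lt_trans with ((b - a + 1) * (e / (2 * (b - a + 1)))).
      + apply Rmult_le_compat_r; lra.
      + replace ((b - a + 1) * (e / (2 * (b - a + 1)))) with (e / 2) by (field; lra). lra. }
  destruct (Rle_lt_dec a b) as [Hab|Hab]; [auto|].
  apply (continuous_ext (fun t => opp (RInt (fun s => h s t) b a))).
  - intros t. apply (opp_RInt_swap (V := R_CompleteNormedModule)). apply ex_RInt_section; assumption.
  - apply (continuous_opp (V := R_NormedModule)). apply Hle. lra.
Qed.

(** As functions of the upper limit of the s integral, both sides vanish at a and have the same
    derivative. *)
Lemma Fubini_continuous (h : R -> R -> R) a b c d :
  (forall x y, continuity_2d_pt h x y) -> a < b ->
  RInt (fun t => RInt (fun s => h s t) a b) c d = RInt (fun s => RInt (fun t => h s t) c d) a b.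
Proof.
  intros Hc Hab.
  assert (Hc' : forall x y, continuity_2d_pt (fun u v => h v u) x y)
    by (intros; apply continuity_2d_pt_swap, Hc).
  set (Phi := fun x => RInt (fun t => RInt (fun s => h s t) a x) c d).
  set (Psi := fun x => RInt (fun s => RInt (fun t => h s t) c d) a x).
  assert (Hin : forall x t, is_derive (fun x => RInt (fun s => h s t) a x) x (h x t)).
  { intros x t. apply (is_derive_RInt (V := R_NormedModule) (fun s => h s t) _ a x).
    - apply filter_forall. intros y. apply (RInt_correct (V := R_CompleteNormedModule)).
      apply ex_RInt_section; assumption.
    - apply (continuous_section h). apply Hc. }
  assert (HPhi : forall x, is_derive Phi x (RInt (fun t => h x t) c d)).
  { intros x.
    replace (RInt (fun t => h x t) c d)
      with (RInt (fun t => Derive (fun u => RInt (fun s => h s t) a u) x) c d).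
    - apply (is_derive_RInt_param (fun x t => RInt (fun s => h s t) a x) c d x).
      + apply filter_forall. intros y t _. exists (h y t). apply Hin.
      + intros t _. apply (continuity_2d_pt_ext h); [|apply Hc].
        intros u v. symmetry. apply is_derive_unique. apply Hin.
      + apply filter_forall. intros y. apply (ex_RInt_continuous (V := R_CompleteNormedModule)).
        intros z _. apply continuous_RInt_section. assumption.
    - apply RInt_ext. intros t _. apply is_derive_unique. apply Hin. }
  assert (HPsi : forall x, is_derive Psi x (RInt (fun t => h x t) c d)).
  { intros x.
    assert (HcJ : forall y, continuous (fun s => RInt (fun t => h s t) c d) y)
      by (intros y; apply (continuous_RInt_section (fun u v => h v u)); assumption).
    apply (is_derive_RInt (V := R_NormedModule) (fun s => RInt (fun t => h s t) c d) _ a x).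
    - apply filter_forall. intros y. apply (RInt_correct (V := R_CompleteNormedModule)).
      apply (ex_RInt_continuous (V := R_CompleteNormedModule)). intros; apply HcJ.
    - apply HcJ. }
  assert (E : Phi a - Psi a = Phi b - Psi b).
  { apply (eq_is_derive (V := R_NormedModule) (fun x => Phi x - Psi x)); [|assumption]. intros x _.
    replace (@zero R_NormedModule) with (minus (RInt (fun t => h x t) c d) (RInt (fun t => h x t) c d)).
    - apply (is_derive_minus (V := R_NormedModule) Phi Psi); [apply HPhi|apply HPsi].
    - apply (minus_eq_zero (G := R_AbelianGroup)). }
  assert (Z : Phi a - Psi a = 0).
  { unfold Phi, Psi. rewrite (RInt_point (V := R_CompleteNormedModule)).
    rewrite (RInt_ext _ (fun _ => 0)).
    - rewrite (RInt_const (V := R_CompleteNormedModule)). unfold scal, zero; simpl. unfold mult; simpl. ring.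
    - intros t _. apply (RInt_point (V := R_CompleteNormedModule)). }
  change (Phi b = Psi b). lra.
Qed.

Lemma Defs_RInt (f : R -> R) a b : ex_RInt f a b -> Defs.RInt f a b = RInt f a b.
Proof.
  intros H. unfold Defs.RInt.
  destruct (ClassicalEpsilon.excluded_middle_informative _) as [H'|H'].
  - symmetry. apply RInt_Reals.
  - exfalso. apply H'. constructor. apply ex_RInt_Reals_0. assumption.
Qed.

Lemma Defs_RInt_iterated (h : R -> R -> R) a b c d :
  (forall x y, continuity_2d_pt h x y) ->
  Defs.RInt (fun s => Defs.RInt (fun t => h s t) c d) a b
  = RInt (fun s => RInt (fun t => h s t) c d) a b.
Proof.
  intros Hc.
  assert (Hc' : forall x y, continuity_2d_pt (fun u v => h v u) x y)
    by (intros; apply continuity_2d_pt_swap, Hc).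
  replace (fun s => Defs.RInt (fun t => h s t) c d) with (fun s => RInt (fun t => h s t) c d).
  - apply Defs_RInt. apply (ex_RInt_continuous (V := R_CompleteNormedModule)). intros s _.
    apply (continuous_RInt_section (fun u v => h v u)). assumption.
  - apply FunctionalExtensionality.functional_extensionality. intros s.
    symmetry. apply Defs_RInt. apply (ex_RInt_section (fun u v => h v u)). assumption.
Qed.

Lemma RInt_lower_bound (f : R -> R) a b a' b' :
  a <= a' -> a' <= b' -> b' <= b -> (forall x, continuous f x) -> (forall x, 0 <= f x) ->
  RInt f a' b' <= RInt f a b.
Proof.
  intros H1 H2 H3 Hc Hp.
  assert (Hex : forall u v, ex_RInt f u v)
    by (intros; apply (ex_RInt_continuous (V := R_CompleteNormedModule)); intros; apply Hc).
  assert (E1 := RInt_Chasles (V := R_CompleteNormedModule) f a a' b (Hex _ _) (Hex _ _)).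
  assert (E2 := RInt_Chasles (V := R_CompleteNormedModule) f a' b' b (Hex _ _) (Hex _ _)).
  assert (A1 : 0 <= RInt f a a') by (apply RInt_ge_0; auto).
  assert (A2 : 0 <= RInt f b' b) by (apply RInt_ge_0; auto).
  unfold plus in E1, E2; simpl in E1, E2. lra.
Qed.

Lemma RInt_inv_shift k c u v : 0 < u -> u <= v ->
  ex_RInt (fun x => k / (x - c)) (c + u) (c + v) /\
  RInt (fun x => k / (x - c)) (c + u) (c + v) = k * (ln v - ln u).
Proof.
  intros Hu Huv.
  assert (H : is_RInt (fun x => k / (x - c)) (c + u) (c + v)
                (minus (k * ln (c + v - c)) (k * ln (c + u - c)))).
  { apply (is_RInt_derive (V := R_CompleteNormedModule) (fun x => k * ln (x - c))); intros x Hx;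
      rewrite Rmin_left, Rmax_right in Hx by lra.
    - auto_derive; [lra|]. field. lra.
    - apply (ex_derive_continuous (fun x => k / (x - c))). auto_derive. lra. }
  split; [eexists; exact H|].
  rewrite (is_RInt_unique (V := R_CompleteNormedModule) _ _ _ _ H).
  replace (c + v - c) with v by ring. replace (c + u - c) with u by ring.
  unfold minus, plus, opp; simpl. ring.
Qed.

Lemma rpow_nonneg x p : 0 <= rpow x p.
Proof.
  unfold rpow. destruct (Rle_dec x 0); [lra|]. apply Rlt_le, exp_pos.
Qed.

Lemma rpow_le x y p : 0 < p -> x <= y -> rpow x p <= rpow y p.
Proof.
  intros Hp Hxy. destruct (Rle_dec x 0) as [Hx|Hx].
  - replace (rpow x p) with 0; [apply rpow_nonneg|]. unfold rpow. destruct (Rle_dec x 0); tauto.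
  - unfold rpow. destruct (Rle_dec x 0); [lra|]. destruct (Rle_dec y 0); [lra|].
    apply Rle_Rpower_l; lra.
Qed.

Lemma rpow_continuous p x : 0 < p -> 0 <= x -> forall eps, 0 < eps -> exists d, 0 < d /\
  forall y, Rabs (y - x) < d -> Rabs (rpow y p - rpow x p) < eps.
Proof.
  intros Hp Hx eps He. destruct (Req_dec x 0) as [->|Hx0].
  - exists (Rpower eps (/ p)). split; [apply exp_pos|]. intros y Hy.
    rewrite Rminus_0_r in Hy. apply Rabs_lt_between in Hy.
    replace (rpow 0 p) with 0 by (unfold rpow; destruct (Rle_dec 0 0); lra).
    rewrite Rminus_0_r, Rabs_pos_eq by apply rpow_nonneg.
    unfold rpow. destruct (Rle_dec y 0); [lra|].
    apply Rlt_le_trans with (Rpower (Rpower eps (/ p)) p).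
    + apply Rlt_Rpower_l; lra.
    + rewrite Rpower_mult, Rinv_l, Rpower_1 by lra. lra.
  - assert (Hc : continuous (fun y => exp (p * ln y)) x).
    { apply (ex_derive_continuous (fun y => exp (p * ln y))). auto_derive. lra. }
    apply continuity_pt_filterlim in Hc. destruct (Hc eps He) as (d & Hd & H).
    exists (Rmin d x). split; [apply Rmin_glb_lt; lra|]. intros y Hy.
    assert (Hyd : Rabs (y - x) < d) by (eapply Rlt_le_trans; [exact Hy|apply Rmin_l]).
    assert (Hyx : Rabs (y - x) < x) by (eapply Rlt_le_trans; [exact Hy|apply Rmin_r]).
    apply Rabs_lt_between in Hyx. unfold rpow.
    destruct (Rle_dec y 0); [lra|]. destruct (Rle_dec x 0); [lra|].
    destruct (Req_dec x y) as [<-|Hne]; [rewrite Rminus_diag, Rabs_R0; lra|].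
    apply (H y). split; [split; [constructor|assumption]|exact Hyd].
Qed.

Definition continuous_D2 (f : C -> C -> C) : Prop :=
  forall w1 w2, inD2 w1 w2 -> forall eps, eps > 0 ->
     exists delta, delta > 0 /\
       forall z1 z2, Cnorm (Csub z1 w1) < delta -> Cnorm (Csub z2 w2) < delta ->
         Cnorm (Csub (f z1 z2) (f w1 w2)) < eps.

Definition mean_integrand (f : C -> C -> C) (p r s t : R) : R :=
  rpow (Cnorm (f (Cscale r (Cexpi s)) (Cscale r (Cexpi t)))) p.

Lemma dilate_in_D r s : 0 < r < 1 -> inD (Cscale r (Cexpi s)).
Proof.
  intros Hr. unfold inD. rewrite Cnorm_Cmod, Cscale_mult, Cmod_dilate, Cmod_Cexpi; lra.
Qed.

Lemma mean_integrand_continuous f p r : continuous_D2 f -> 0 < p -> 0 < r < 1 ->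
  forall x y, continuity_2d_pt (mean_integrand f p r) x y.
Proof.
  intros Hf Hp Hr x y eps.
  set (zx := Cscale r (Cexpi x)). set (zy := Cscale r (Cexpi y)).
  destruct (rpow_continuous p (Cnorm (f zx zy)) Hp) with (eps := eps : R) as (d1 & Hd1 & H1).
  { rewrite Cnorm_Cmod. apply Cmod_ge_0. }
  { apply cond_pos. }
  destruct (Hf zx zy (conj (dilate_in_D r x Hr) (dilate_in_D r y Hr)) d1 Hd1) as (d2 & Hd2 & H2).
  exists (mkposreal d2 Hd2). intros u v Hu Hv. simpl in Hu, Hv.
  assert (D : forall a b, Rabs (a - b) < d2 ->
    Cnorm (Csub (Cscale r (Cexpi a)) (Cscale r (Cexpi b))) < d2).
  { intros a b Hab. rewrite Cnorm_Cmod, !Cscale_mult.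
    change (Cmod (r * Cexpi a - r * Cexpi b) < d2).
    replace (r * Cexpi a - r * Cexpi b)%C with (r * (Cexpi a - Cexpi b))%C by (Ceq; ring).
    rewrite Cmod_dilate by lra. generalize (Cmod_Cexpi_diff a b) (Cmod_ge_0 (Cexpi a - Cexpi b)). nra. }
  apply H1. apply Rle_lt_trans with (Cnorm (Csub (f (Cscale r (Cexpi u)) (Cscale r (Cexpi v))) (f zx zy))).
  - rewrite !Cnorm_Cmod.
    change (Rabs (Cmod (f (Cscale r (Cexpi u)) (Cscale r (Cexpi v))) - Cmod (f zx zy))
            <= Cmod (f (Cscale r (Cexpi u)) (Cscale r (Cexpi v)) - f zx zy)).
    set (A := f (Cscale r (Cexpi u)) (Cscale r (Cexpi v))). set (B := f zx zy).
    assert (X1 := Cmod_ge_sub A B). assert (X2 := Cmod_ge_sub B A). rewrite Cmod_sub_sym in X2.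
    apply Rabs_le. lra.
  - apply H2; apply D; assumption.
Qed.

(** * Divergence of the torus means *)

Lemma unit_circle_angle (z : C) : Cmod z = 1 -> exists s, 0 <= s < 2 * PI /\ z = Cexpi s.
Proof.
  intros Hz. destruct z as [x y].
  assert (E := Cmod_sqr (x, y)). rewrite Hz in E. simpl in E.
  assert (Hx : -1 <= x <= 1) by nra.
  assert (Hpi := PI_RGT_0). assert (HB := acos_bound x).
  destruct (Rle_lt_dec 0 y) as [Hy|Hy].
  - exists (acos x). split; [lra|]. unfold Cexpi. rewrite cos_acos, sin_acos by assumption.
    f_equal. symmetry. rewrite <- (sqrt_Rsqr y Hy). f_equal. unfold Rsqr. lra.
  - exists (- acos x + 2 * PI). split.
    + split; [lra|]. destruct (Req_dec (acos x) 0) as [E0|E0]; [|lra].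
      assert (x = 1) by (rewrite <- (cos_acos x Hx), E0; apply cos_0). nra.
    + assert (Hs : sqrt (1 - Rsqr x) = - y).
      { rewrite <- (sqrt_Rsqr (- y)) by lra. f_equal. unfold Rsqr. lra. }
      unfold Cexpi. rewrite cos_plus, sin_plus, cos_2PI, sin_2PI, cos_neg, sin_neg.
      rewrite cos_acos, sin_acos, Hs by assumption. f_equal; ring.
Qed.

Lemma Cexpi_local_inj th a b : 0 < a <= 1 -> 0 < b <= 1 ->
  Cexpi (th + a) = Cexpi (th + b) -> a = b.
Proof.
  intros Ha Hb E. rewrite !Cexpi_plus in E.
  assert (Ht : Cexpi th <> RtoC 0).
  { intros F. assert (A := Cmod_Cexpi th). rewrite F, Cmod_0 in A. lra. }
  assert (E' : Cexpi a = Cexpi b).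
  { replace (Cexpi a : C) with ((Cexpi th * Cexpi a) / Cexpi th)%C by (Ceq; field; assumption).
    rewrite E. Ceq; field; assumption. }
  unfold Cexpi in E'. inversion E' as [[Hc Hs]].
  assert (Hp := PI2_1). assert (Hp0 := PI_RGT_0).
  destruct (Rtotal_order a b) as [L|[L|L]]; [|assumption|];
    apply cos_decreasing_1 in L; lra.
Qed.

(** Each listed point excludes at most one t in (0, 1], as t -> e^{i(th + t)} is injective there. *)
Lemma avoid_finite (L : list (C * C)) th :
  exists t1, 0 < t1 <= 1 /\ forall t, 0 < t < t1 -> forall z, ~ In (z, Cexpi (th + t)) L.
Proof.
  induction L as [|[a b] L (t1 & Ht1 & H)].
  - exists 1. split; [lra|]. intros t _ z [].
  - destruct (classic (exists t, 0 < t <= 1 /\ b = Cexpi (th + t))) as [(t2 & Ht2 & E)|N].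
    + exists (Rmin t1 t2). split; [split; [apply Rmin_glb_lt; lra|generalize (Rmin_l t1 t2); lra]|].
      intros t Ht z. generalize (Rmin_l t1 t2) (Rmin_r t1 t2); intros M1 M2. intros [F|F].
      * inversion F as [[F1 F2]]. rewrite E in F2.
        assert (t2 = t) by (apply (Cexpi_local_inj th); [lra|lra|assumption]). lra.
      * apply (H t) in F; [assumption|lra].
    + exists t1. split; [assumption|]. intros t Ht z [F|F].
      * apply N. exists t. inversion F. split; [lra|reflexivity].
      * apply (H t) in F; assumption.
Qed.

(** At the angle s0 of conj(g)/|g| the distance |1 - g e^{is}| equals y = 1 - |g|, and moving by at
    most y adds at most y. The arc lies on one side of s0, chosen so that it stays within
    [0, 2 PI]. *)
Lemma arc_near_root (g : C) : 0 < 1 - Cmod g <= 1 / 36 ->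
  exists a, 0 <= a /\ a + (1 - Cmod g) <= 2 * PI /\
    forall s, a <= s <= a + (1 - Cmod g) -> Cmod (1 - g * Cexpi s) <= 2 * (1 - Cmod g).
Proof.
  intros Hy. set (y := 1 - Cmod g) in *.
  assert (Hg : 0 < Cmod g) by (unfold y in Hy; lra).
  assert (Hg0 : g <> RtoC 0) by (apply Cmod_gt_0; assumption).
  assert (Hgm : RtoC (Cmod g) <> RtoC 0) by (intros F; apply RtoC_inj in F; lra).
  destruct (unit_circle_angle (Cconj g / Cmod g)%C) as (s0 & Hs0 & E).
  { rewrite Cmod_div by assumption. rewrite Cmod_conj, Cmod_R, Rabs_pos_eq by lra. field. lra. }
  assert (E1 : (g * Cexpi s0)%C = RtoC (Cmod g)).
  { rewrite <- E. replace (g * (Cconj g / Cmod g))%C with ((g * Cconj g) / Cmod g)%C by (field; assumption).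
    rewrite <- Cmod2_conj, RtoC_pow. field. assumption. }
  assert (A : forall s, Rabs (s - s0) <= y -> Cmod (1 - g * Cexpi s) <= 2 * y).
  { intros s Hs.
    replace (1 - g * Cexpi s)%C with ((1 - g * Cexpi s0) - g * (Cexpi s - Cexpi s0))%C by (Ceq; ring).
    eapply Rle_trans; [apply Cmod_minus_le|]. rewrite E1, <- RtoC_minus, Cmod_R, Rabs_pos_eq by (fold y; lra).
    fold y. rewrite Cmod_mult.
    generalize (Cmod_Cexpi_diff s s0) (Cmod_ge_0 (Cexpi s - Cexpi s0)). unfold y in *. nra. }
  assert (Hpi := PI2_1).
  destruct (Rle_lt_dec s0 PI).
  - exists s0. split; [lra|]. split; [lra|]. intros s Hs. apply A. apply Rabs_le. lra.
  - exists (s0 - y). split; [lra|]. split; [lra|]. intros s Hs. apply A. apply Rabs_le. lra.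
Qed.

Lemma Rpower_three_halves x : 0 < x -> Rpower x (3 / 2) = x * sqrt x.
Proof.
  intros Hx. replace (3 / 2) with (1 + / 2) by field.
  rewrite Rpower_plus, Rpower_1, Rpower_sqrt by assumption. reflexivity.
Qed.

(** y (36 y)^(-3/2) = 1 / (216 sqrt y), with 216 = 36^(3/2), and sqrt y <= sqrt kk t. As y <= 1/36
    makes the base at least 1, a larger exponent only helps. *)
Lemma peak_mass y kk t pp : 3 / 2 <= pp -> 0 < t -> 0 < kk -> 0 < y <= 1 / 36 -> y <= kk * t ^ 2 ->
  / (216 * sqrt kk) / t <= y * rpow (/ (36 * y)) pp.
Proof.
  intros Hpp Ht Hk Hy Hyt. set (x := / (36 * y)).
  assert (Hx : 1 <= x).
  { unfold x. rewrite <- Rinv_1. apply Rinv_le_contravar; lra. }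
  assert (Hr : x * sqrt x <= rpow x pp).
  { rewrite <- Rpower_three_halves by lra. unfold rpow. destruct (Rle_dec x 0); [lra|].
    apply Rle_Rpower; lra. }
  apply Rle_trans with (y * (x * sqrt x)); [|apply Rmult_le_compat_l; lra].
  replace (y * (x * sqrt x)) with (/ 36 * sqrt x) by (unfold x; field; lra).
  assert (Hs : / (6 * sqrt kk * t) <= sqrt x).
  { assert (Hsk : 0 < sqrt kk) by (apply sqrt_lt_R0; assumption).
    assert (Hp : 0 < 6 * sqrt kk * t) by nra.
    apply Rsqr_incr_0_var; [|apply sqrt_pos]. rewrite Rsqr_sqrt by lra.
    unfold x, Rsqr. rewrite <- Rinv_mult. apply Rinv_le_contravar; [lra|].
    replace (6 * sqrt kk * t * (6 * sqrt kk * t)) with (36 * (sqrt kk * sqrt kk) * t ^ 2) by ring.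
    rewrite sqrt_sqrt by lra. lra. }
  assert (Hsk : 0 < sqrt kk) by (apply sqrt_lt_R0; assumption).
  replace (/ (216 * sqrt kk) / t) with (/ 36 * / (6 * sqrt kk * t)) by (field; lra).
  lra.
Qed.

Lemma torus_integral_unbounded P f pp :
  no_zeros_in_D2 P -> finitely_many_zeros_on_T2 P ->
  (exists z v, Cmod z = 1 /\ Cmod v = 1 /\ peval P z v = RtoC 0) ->
  (forall z v, inD2 z v -> is_partial1_at (RIF P) z v (f z v)) ->
  continuous_D2 f -> 3 / 2 <= pp ->
  forall M, exists r, 0 < r < 1 /\
    M < RInt (fun t => RInt (fun s => mean_integrand f pp r s t) 0 (2 * PI)) 0 (2 * PI).
Proof.
  intros Hno Hfin (tau1 & tau2 & Ht1 & Ht2 & H0) Hpart Hcont Hpp M.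
  destruct (boundary_root_quadratic P tau1 tau2 Hno Hfin Ht1 Ht2 H0) as (K & t0 & HK & Ht0 & Hroot).
  destruct (unit_circle_angle tau2 Ht2) as (th & Hth & Eth).
  destruct Hfin as (L & HL).
  destruct (avoid_finite L th) as (t1 & Ht1' & Havoid).
  set (kk := K + 1). assert (Hkk : 0 < kk) by (unfold kk; lra).
  (* In order: a root close to the circle exists; p has no zero on these slices of the torus; th + t
     stays in [0, 2 PI]; y <= kk t^2 <= 1/36. *)
  set (tm := Rmin (Rmin t0 (t1 / 2)) (Rmin (2 * PI - th) (/ (36 * kk)))).
  assert (Hik : 0 < / (36 * kk)) by (apply Rinv_0_lt_compat; lra).
  assert (Htm : 0 < tm) by (repeat apply Rmin_glb_lt; lra).
  assert (M1 : tm <= t0) by (eapply Rle_trans; [apply Rmin_l|apply Rmin_l]).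
  assert (M2 : tm <= t1 / 2) by (eapply Rle_trans; [apply Rmin_l|apply Rmin_r]).
  assert (M3 : tm <= 2 * PI - th) by (eapply Rle_trans; [apply Rmin_r|apply Rmin_l]).
  assert (M4 : tm <= / (36 * kk)) by (eapply Rle_trans; [apply Rmin_r|apply Rmin_r]).
  assert (M5 : kk * tm <= 1 / 36).
  { apply Rle_trans with (kk * / (36 * kk)); [apply Rmult_le_compat_l; lra|].
    apply Req_le. field. lra. }
  assert (Hnz : forall z t, Cmod z = 1 -> 0 < t <= tm -> peval P z (Cexpi (th + t)) <> RtoC 0).
  { intros z t Hz Ht E. apply (Havoid t ltac:(lra) z). apply HL; [|exact E].
    split; unfold inT; rewrite Cnorm_Cmod; [exact Hz|apply Cmod_Cexpi]. }
  set (kap := / (216 * sqrt kk)).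
  assert (Hkap : 0 < kap).
  { apply Rinv_0_lt_compat. assert (0 < sqrt kk) by (apply sqrt_lt_R0; assumption). lra. }
  (* Chosen so that kap ln(tm / eps) = |M| + 1. *)
  set (eps := tm * exp (- ((Rabs M + 1) / kap))).
  assert (Hx : 0 < (Rabs M + 1) / kap) by (apply Rdiv_lt_0_compat; [generalize (Rabs_pos M); lra|assumption]).
  assert (Heps : 0 < eps < tm).
  { assert (A := exp_pos (- ((Rabs M + 1) / kap))).
    assert (B : exp (- ((Rabs M + 1) / kap)) < 1) by (apply Rlt_le_trans with (exp 0); [apply exp_increasing; lra|rewrite exp_0; lra]).
    unfold eps. split; nra. }
  destruct (slope_dilate P 0 (2 * PI) (th + eps) (th + tm)) as (K' & r0 & HK' & Hr0 & Hdil).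
  { intros s t Hs Ht. replace t with (th + (t - th)) by ring. apply Hnz; [apply Cmod_Cexpi|lra]. }
  (* The loss K' (1 - r) is at most 1/36 <= 1 / (36 y), so the bound 1 / (18 y) on the torus leaves
     1 / (36 y) at radius r. *)
  set (r := 1 - Rmin (1 - r0) (/ (36 * (K' + 1)))).
  assert (Hi : 0 < / (36 * (K' + 1))) by (apply Rinv_0_lt_compat; lra).
  assert (R1 := Rmin_l (1 - r0) (/ (36 * (K' + 1)))).
  assert (R2 := Rmin_r (1 - r0) (/ (36 * (K' + 1)))).
  assert (R3 : 0 < Rmin (1 - r0) (/ (36 * (K' + 1)))) by (apply Rmin_glb_lt; lra).
  assert (Hr : r0 <= r < 1) by (unfold r; lra).
  assert (Hr2 : K' * (1 - r) <= 1 / 36).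
  { apply Rle_trans with ((K' + 1) * / (36 * (K' + 1))).
    - apply Rmult_le_compat; unfold r; lra.
    - apply Req_le. field. lra. }
  exists r. split; [lra|].
  set (h := mean_integrand f pp r).
  assert (Hh : forall x y, continuity_2d_pt h x y) by (apply mean_integrand_continuous; [assumption|lra|lra]).
  assert (Hh0 : forall x y, 0 <= h x y) by (intros; apply rpow_nonneg).
  assert (Hpi := PI_RGT_0).
  set (J := fun t => RInt (fun s => h s t) 0 (2 * PI)).
  assert (HJc : forall t, continuous J t) by (intros; apply continuous_RInt_section; assumption).
  assert (HJ0 : forall t, 0 <= J t).
  { intros t. apply RInt_ge_0; [lra|apply ex_RInt_section; assumption|auto]. }
  assert (HJ : forall x, th + eps <= x <= th + tm -> kap / (x - th) <= J x).
  { intros x Hx'. set (t := x - th). assert (Ht : eps <= t <= tm) by (unfold t; lra).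
    assert (Ex : x = th + t) by (unfold t; ring). clearbody t. subst x.
    destruct (Hroot t) as (l & g & Hl & Hfac & Hb & Hg & Hgt).
    { rewrite Rabs_pos_eq; lra. }
    replace (tau2 * Cexpi t)%C with (Cexpi (th + t) : C) in Hfac by (rewrite Eth; apply Cexpi_plus).
    set (v := Cexpi (th + t) : C) in *.
    assert (Hv : Cmod v = 1) by apply Cmod_Cexpi.
    set (y := 1 - Cmod g).
    assert (Hyk : y <= kk * t ^ 2).
    { unfold y, kk. assert (0 <= t ^ 2) by apply pow2_ge_0. lra. }
    assert (Hgb := Hb g Hg).
    (* y = 0 would place the zero 1/g of the slice on the circle, which [Hnz] excludes for 0 < t <=
       tm. *)
    assert (Hy : 0 < y).
    { destruct (Rle_lt_dec y 0) as [N|]; [exfalso|assumption].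
      assert (Hg1 : Cmod g = 1) by (unfold y in N; lra).
      assert (Hg0 : g <> RtoC 0) by (intros F; rewrite F, Cmod_0 in Hg1; lra).
      apply (Hnz (/ g)%C t).
      - rewrite Cmod_inv, Hg1 by assumption. field.
      - lra.
      - fold v. rewrite Hfac.
        rewrite (prodC_zero (fun a => (1 - a * / g)%C) g l Hg); [Ceq; ring|].
        field. assumption. }
    assert (Hy36 : y <= 1 / 36).
    { assert (t ^ 2 <= tm) by nra. assert (kk * t ^ 2 <= kk * tm) by (apply Rmult_le_compat_l; lra). lra. }
    destruct (arc_near_root g ltac:(fold y; lra)) as (a & Ha0 & Ha1 & Harc). fold y in Ha1, Harc.
    replace (kap / (th + t - th)) with (kap / t) by (f_equal; ring).
    apply Rle_trans with (y * rpow (/ (36 * y)) pp).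
    { apply (peak_mass y kk t pp); [assumption|lra|lra|lra|assumption]. }
    apply Rle_trans with (RInt (fun s => h s (th + t)) a (a + y)).
    2:{ apply RInt_lower_bound; [lra|lra|lra| |auto].
        intros s. apply (continuous_section h). apply Hh. }
    replace (y * rpow (/ (36 * y)) pp) with (RInt (fun _ => rpow (/ (36 * y)) pp) a (a + y)).
    2:{ rewrite (RInt_const (V := R_CompleteNormedModule)). unfold scal; simpl. unfold mult; simpl. ring. }
    apply RInt_le; [lra|apply ex_RInt_const|apply ex_RInt_section; assumption|].
    intros s Hs. unfold h, mean_integrand. apply rpow_le; [lra|].
    assert (Hin : inD2 (Cscale r (Cexpi s)) (Cscale r (Cexpi (th + t))))
      by (split; apply dilate_in_D; lra).
    rewrite (partial1_slope P _ _ _ Hno Hin (Hpart _ _ Hin)), Cnorm_Cmod.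
    rewrite !Cscale_mult.
    assert (A1 := Hdil r s (th + t) Hr ltac:(lra) ltac:(lra)).
    assert (A2 : / (18 * y) <= Cmod (slope P (Cexpi s) (Cexpi s) v)).
    { apply (slope_boundary_lower P v (peval P (RtoC 0) v) l g); try assumption.
      - unfold y in Hy; lra.
      - apply Cmod_Cexpi.
      - apply Hnz; [apply Cmod_Cexpi|lra].
      - apply Harc. lra. }
    fold v in A1.
    assert (A3 : / (36 * y) <= / (18 * y) - 1 / 36).
    { replace (/ (18 * y)) with (2 * / (36 * y)) by (field; lra).
      assert (1 / 36 <= / (36 * y)); [|lra].
      replace (1 / 36) with (/ 36) by field. apply Rinv_le_contravar; lra. }
    fold v. lra. }
  change (M < RInt J 0 (2 * PI)).
  apply Rlt_le_trans with (RInt J (th + eps) (th + tm)).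
  2:{ apply RInt_lower_bound; [lra|lra|lra|assumption|assumption]. }
  destruct (RInt_inv_shift kap th eps tm) as (Hex & Eln); [lra|lra|].
  apply Rlt_le_trans with (RInt (fun x => kap / (x - th)) (th + eps) (th + tm)).
  - rewrite Eln. unfold eps. rewrite ln_mult, ln_exp by (try apply exp_pos; lra).
    replace (kap * (ln tm - (ln tm + - ((Rabs M + 1) / kap)))) with (Rabs M + 1) by (field; lra).
    generalize (Rle_abs M). lra.
  - apply RInt_le; [lra|assumption| |].
    + apply (ex_RInt_continuous (V := R_CompleteNormedModule)). intros; apply HJc.
    + intros x Hx'. apply HJ. lra.
Qed.

(** * Exchanging the variables *)

Definition pswap (P : poly2) : poly2 := Poly2 (pd2 P) (pd1 P) (fun i j => coef P j i).

Lemma peval_pswap P z w : peval (pswap P) z w = peval P w z.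
Proof.
  rewrite !peval_Csum, Csum_exchange. apply Csum_ext. intros i _. apply Csum_ext. intros j _.
  simpl coef. Ceq; ring.
Qed.

Lemma RIF_pswap P z w : RIF (pswap P) z w = RIF P w z.
Proof.
  unfold RIF. rewrite peval_pswap. f_equal. apply (peval_pswap (ptilde P)).
Qed.

Lemma no_zeros_pswap P : no_zeros_in_D2 P -> no_zeros_in_D2 (pswap P).
Proof. intros H z w [Hz Hw]. rewrite peval_pswap. apply H. split; assumption. Qed.

Lemma finite_zeros_pswap P :
  finitely_many_zeros_on_T2 P -> finitely_many_zeros_on_T2 (pswap P).
Proof.
  intros (L & H). exists (map (fun x => (snd x, fst x)) L). intros z w [Hz Hw] E.
  rewrite peval_pswap in E. apply in_map_iff. exists (w, z). split; [reflexivity|].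
  apply H; [split; assumption|exact E].
Qed.

(** The mixed faces of the boundary, disc times circle and circle times disc, carry no zeros.
    Without a zero on the torus, p would have none on the closed bidisc, and phi itself would be the
    continuous extension. *)
Lemma boundary_zero_exists P : no_zeros_in_D2 P -> finitely_many_zeros_on_T2 P ->
  ~ extends_continuously_to_closed_bidisc (RIF P) ->
  exists z v, Cmod z = 1 /\ Cmod v = 1 /\ peval P z v = RtoC 0.
Proof.
  intros Hno Hfin Hext. apply NNPP. intros Hn. apply Hext.
  assert (Hnz : forall z v, Cmod z <= 1 -> Cmod v <= 1 -> peval P z v <> RtoC 0).
  { intros z v Hz Hv.
    destruct (Rle_lt_or_eq_dec _ _ Hz) as [Hz1|Hz1];
      destruct (Rle_lt_or_eq_dec _ _ Hv) as [Hv1|Hv1].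
    - apply Hno. split; unfold inD; rewrite Cnorm_Cmod; assumption.
    - apply no_zeros_D_times_T; assumption.
    - rewrite <- peval_pswap.
      apply no_zeros_D_times_T; auto using no_zeros_pswap, finite_zeros_pswap.
    - intros E. apply Hn. exists z, v. auto. }
  exists (RIF P). split; [reflexivity|].
  intros w1 w2 [H1 H2] eps He. unfold inDbar in H1, H2. rewrite Cnorm_Cmod in H1, H2.
  destruct (lip2_common _ _ (lip2_peval (ptilde P)) (lip2_peval P)) as (K & HK & H).
  assert (Hc := proj1 (Cmod_gt_0 _) (Hnz w1 w2 H1 H2)).
  set (c := Cmod (peval P w1 w2)) in *.
  set (K' := 2 * K / c + 2 * K * K / (c * c)).
  assert (HK' : 0 <= K').
  { assert (0 <= 2 * K / c) by (apply Rmult_le_pos; [lra|apply Rlt_le, Rinv_0_lt_compat; lra]).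
    assert (0 <= 2 * K * K / (c * c)).
    { apply Rmult_le_pos; [nra|]. apply Rlt_le, Rinv_0_lt_compat. nra. }
    unfold K'; lra. }
  set (d := Rmin (c / (4 * (K + 1))) (eps / (4 * (K' + 1)))).
  assert (Hd : 0 < d) by (apply Rmin_glb_lt; apply Rdiv_lt_0_compat; lra).
  assert (Hd1 : d <= c / (4 * (K + 1))) by apply Rmin_l.
  assert (Hd2 : d <= eps / (4 * (K' + 1))) by apply Rmin_r.
  exists d. split; [assumption|]. intros z1 z2 [Hz1 Hz2]. unfold inDbar in Hz1, Hz2.
  rewrite !Cnorm_Cmod in *. intros D1 D2.
  change (Cmod (z1 - w1) < d) in D1. change (Cmod (z2 - w2) < d) in D2.
  destruct (H z1 z2 w1 w2 Hz1 Hz2 H1 H2) as (_ & A1 & A2).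
  destruct (H w1 w2 w1 w2 H1 H2 H1 H2) as (A3 & _).
  assert (A4 : K * (Cmod (z1 - w1) + Cmod (z2 - w2)) <= K * (2 * d))
    by (apply Rmult_le_compat_l; lra).
  destruct (quotient_lipschitz (peval (ptilde P) z1 z2) (peval (ptilde P) w1 w2)
     (peval P z1 z2) (peval P w1 w2) K c (2 * d)) as (_ & Hq); try lra; try apply Rle_refl; try assumption.
  - apply Rle_trans with ((K + 1) * (2 * (c / (4 * (K + 1))))).
    + apply Rmult_le_compat; lra.
    + apply Req_le. field. lra.
  - fold K' in Hq. change (Cmod (RIF P z1 z2 - RIF P w1 w2) < eps). rewrite !RIF_div.
    eapply Rle_lt_trans; [exact Hq|].
    apply Rle_lt_trans with ((K' + 1) * (2 * (eps / (4 * (K' + 1))))).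
    + apply Rmult_le_compat; lra.
    + replace ((K' + 1) * (2 * (eps / (4 * (K' + 1))))) with (eps / 2) by (field; lra). lra.
Qed.

Lemma torus_mean_RInt f p r : continuous_D2 f -> 0 < p -> 0 < r < 1 ->
  torus_mean f p r = / (4 * PI ^ 2) *
    RInt (fun s => RInt (fun t => mean_integrand f p r s t) 0 (2 * PI)) 0 (2 * PI).
Proof.
  intros Hf Hp Hr. unfold torus_mean. f_equal.
  apply (Defs_RInt_iterated (mean_integrand f p r)).
  apply mean_integrand_continuous; assumption.
Qed.

Lemma torus_mean_unbounded P f j pp :
  no_zeros_in_D2 P -> finitely_many_zeros_on_T2 P ->
  ~ extends_continuously_to_closed_bidisc (RIF P) -> j = 1%nat \/ j = 2%nat ->
  is_partial j (RIF P) f -> continuous_D2 f -> 3 / 2 <= pp ->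
  forall M, exists r, 0 < r < 1 /\ M < torus_mean f pp r.
Proof.
  intros Hno Hfin Hext Hj Hpart Hcont Hpp M.
  destruct (boundary_zero_exists P Hno Hfin Hext) as (z & v & Hz & Hv & E).
  assert (Hpi := PI_RGT_0).
  assert (H4 : 0 < 4 * PI ^ 2) by (simpl; nra).
  assert (HM : forall x, 4 * PI ^ 2 * M < x -> M < / (4 * PI ^ 2) * x).
  { intros x Hx. apply Rmult_lt_reg_l with (4 * PI ^ 2); [assumption|].
    rewrite <- Rmult_assoc, Rinv_r, Rmult_1_l by lra. assumption. }
  destruct Hj as [->| ->].
  - destruct (torus_integral_unbounded P f pp Hno Hfin) with (M := 4 * PI ^ 2 * M) as (r & Hr & H).
    + exists z, v. auto.
    + intros z1 z2 Hin. apply Hpart; auto.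
    + assumption.
    + assumption.
    + exists r. split; [assumption|]. rewrite torus_mean_RInt by (try assumption; lra).
      (* [torus_mean] integrates the second angle inside, the slice estimate the first. For j = 2
         the exchange of variables already matches the two orders. *)
      apply HM. rewrite <- Fubini_continuous.
      * exact H.
      * apply mean_integrand_continuous; [assumption|lra|lra].
      * lra.
  - destruct (torus_integral_unbounded (pswap P) (fun a b => f b a) pp) with (M := 4 * PI ^ 2 * M)
      as (r & Hr & H).
    + apply no_zeros_pswap; assumption.
    + apply finite_zeros_pswap; assumption.
    + exists v, z. rewrite peval_pswap. auto.
    + intros z1 z2 [Hz1 Hz2] eps He. destruct (Hpart z2 z1 (conj Hz2 Hz1)) as [_ Hp2].
      destruct (Hp2 eq_refl eps He) as (del & Hdel & Hd). exists del. split; [assumption|].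
      intros k Hk Hkd. rewrite !RIF_pswap. apply Hd; assumption.
    + intros w1 w2 [Hw1 Hw2] eps He. destruct (Hcont w2 w1 (conj Hw2 Hw1) eps He) as (del & Hdel & Hd).
      exists del. split; [assumption|]. intros z1 z2 D1 D2. apply Hd; assumption.
    + assumption.
    + exists r. split; [assumption|]. rewrite torus_mean_RInt by (try assumption; lra).
      apply HM. exact H.
Qed.

(** Reduces bounded derivatives to the exponent 3/2; the factor 4 PI^2 is the area of the square of
    angles. *)
Lemma torus_mean_bounded f p M r : continuous_D2 f -> 0 < p -> 0 < r < 1 ->
  (forall z v, inD2 z v -> Cnorm (f z v) <= M) -> torus_mean f p r <= rpow M p.
Proof.
  intros Hf Hp Hr HM. rewrite torus_mean_RInt by assumption.
  assert (Hpi := PI_RGT_0).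
  assert (Hc := mean_integrand_continuous f p r Hf Hp Hr).
  assert (Hc' : forall x y, continuity_2d_pt (fun u w => mean_integrand f p r w u) x y)
    by (intros; apply continuity_2d_pt_swap, Hc).
  set (h := mean_integrand f p r) in *.
  assert (Hh : forall s t, 0 <= h s t <= rpow M p).
  { intros s t. split; [apply rpow_nonneg|]. apply rpow_le; [assumption|].
    apply HM. split; apply dilate_in_D; assumption. }
  assert (A : Rabs (RInt (fun s => RInt (fun t => h s t) 0 (2 * PI)) 0 (2 * PI))
              <= (2 * PI - 0) * ((2 * PI - 0) * rpow M p)).
  { apply abs_RInt_le_const; [lra| |].
    - apply (ex_RInt_continuous (V := R_CompleteNormedModule)). intros s _.
      apply (continuous_RInt_section (fun u w => h w u)). assumption.
    - intros s _. apply abs_RInt_le_const; [lra| |].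
      + apply (ex_RInt_section (fun u w => h w u)). assumption.
      + intros t _. rewrite Rabs_pos_eq; apply Hh. }
  assert (H4 : 0 < 4 * PI ^ 2) by (simpl; nra).
  apply Rmult_le_reg_l with (4 * PI ^ 2); [assumption|].
  rewrite <- Rmult_assoc, Rinv_r, Rmult_1_l by lra.
  eapply Rle_trans; [apply Rle_abs|]. eapply Rle_trans; [exact A|]. apply Req_le. ring.
Qed.

Theorem theorem5p1 :
  forall (p : poly2) (m n : nat),
    has_bidegree p m n ->
    no_zeros_in_D2 p ->
    atoral p ->
    ~ extends_continuously_to_closed_bidisc (RIF p) ->
    forall (j : nat), (j = 1%nat \/ j = 2%nat) ->
    forall f : Cx -> Cx -> Cx, is_partial j (RIF p) f ->
      (forall pp : R, 3 / 2 <= pp -> ~ in_Hp pp f) /\ ~ in_Hinf f.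
Proof.
  intros p m n _ Hno [Hfin _] Hext j Hj f Hf. split.
  - intros pp Hpp [[Hc _] [M HM]].
    destruct (torus_mean_unbounded p f j pp Hno Hfin Hext Hj Hf Hc Hpp M) as (r & Hr & H).
    specialize (HM r Hr). lra.
  - intros [[Hc _] [M HM]].
    destruct (torus_mean_unbounded p f j (3 / 2) Hno Hfin Hext Hj Hf Hc (Rle_refl _) (rpow M (3 / 2)))
      as (r & Hr & H).
    assert (A := torus_mean_bounded f (3 / 2) M r Hc ltac:(lra) Hr HM). lra.
Qed.
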